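(* Let $k$ be an algebraically closed field, $d\ge 2$, $M=(x_1,\ldots,x_d)$ the maximal homogeneous ideal of $k[x_1,\ldots,x_d]$, and $R=k[x_1,\ldots,x_d]_M$ (a regular local ring with maximal ideal $MR$, also denoted $M$). Let $I\subseteq R$ be a finitely supported monomial ideal. Then (1) $\displaystyle\ell\left(\overline{I}/\overline{MI}\right)=\binom{o(I)+d-1}{d-1}$; (2) if $d\ge3$ and $I$ is integrally closed, then $MI$ is integrally closed if and only if $\displaystyle\mu(I)=\binom{o(I)+d-1}{d-1}$.
   Context: A monomial ideal is one generated by monomials in $x_1,\ldots,x_d$. $\overline J$ denotes integral closure, $\mu$ the minimal number of generators, $\ell$ length, $o(I)=\max\{n:I\subseteq M^n\}$. Finitely supported: $I\ne0$ has only finitely many base points, where a base point is a regular local ring $S$ obtained from $R$ by a finite sequence of quadratic transformations (local rings at points of the exceptional fibre of the blowing up of the maximal ideal, $S=R$ allowed) with $o(I^S)\ge1$, the transform being defined by $I^{R_0}=I$, $I^{R_{i-1}}R_i=(M_{i-1}R_i)^{o(I^{R_{i-1}})}I^{R_i}$. *)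

(* Defs.v *)
From Stdlib Require List.
From mathcomp Require Import all_boot all_algebra.
From mathcomp Require Import mpoly.
Set Implicit Arguments. Unset Strict Implicit. Unset Printing Implicit Defensive.
Import GRing.Theory.
Local Open Scope ring_scope.

Section CommAlg.
Variable F : fieldType.
Notation set := (F -> Prop).

Definition subset (A B : set) := forall x, A x -> B x.
Definition seteq (A B : set) := forall x, A x <-> B x.

Definition subring (S : set) :=
  S 0 /\ S 1 /\ (forall a b, S a -> S b -> S (a - b)) /\
  (forall a b, S a -> S b -> S (a * b)).

Definition is_ideal (S J : set) :=
  subset J S /\ J 0 /\ (forall a b, J a -> J b -> J (a + b)) /\
  (forall s a, S s -> J a -> J (s * a)).

Definition gen (S G : set) : set :=
  fun x => forall J, is_ideal S J -> subset G J -> J x.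

Definition iprod (S I J : set) : set :=
  gen S (fun z => exists a b, I a /\ J b /\ z = a * b).

Fixpoint ipow (S I : set) (n : nat) : set :=
  match n with 0 => S | n'.+1 => iprod S (ipow S I n') I end.

(* the maximal ideal of a local subring S: its non-units *)
Definition maxid (S : set) : set :=
  fun x => S x /\ ~ (x != 0 /\ S x^-1).

Definition ord_eq (S I : set) (n : nat) :=
  subset I (ipow S (maxid S) n) /\ ~ subset I (ipow S (maxid S) n.+1).

(* the affine chart S[m/x] of the blowing up of m = maxid S *)
Definition chart (S : set) (x : F) : set :=
  fun y => exists n a, ipow S (maxid S) n a /\ y = a / x ^+ n.

Definition prime_ideal (A P : set) :=
  is_ideal A P /\ ~ P 1 /\ (forall a b, A a -> A b -> P (a * b) -> P a \/ P b).

Definition localize (A P : set) : set :=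
  fun y => exists u v, A u /\ A v /\ ~ P v /\ y = u / v.

(* S' is a quadratic transformation of S: the local ring of a point of the
   exceptional fibre of the blowing up of the maximal ideal of S *)
Definition quad_transform (S S' : set) :=
  exists x P, maxid S x /\ x != 0 /\ prime_ideal (chart S x) P /\
    subset (maxid S) P /\ seteq S' (localize (chart S x) P).

Definition is_transform (S I S' J : set) :=
  exists n, ord_eq S I n /\ is_ideal S' J /\
    seteq (gen S' I) (iprod S' (ipow S' (gen S' (maxid S)) n) J).

Inductive infnear (S I : set) : set -> set -> Prop :=
| infnear_refl : infnear S I S I
| infnear_step T J T' J' : infnear S I T J -> quad_transform T T' ->
    is_transform T J T' J' -> infnear S I T' J'.

Definition base_point (S I T : set) :=
  exists J, infnear S I T J /\ subset J (ipow T (maxid T) 1).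

Definition finitely_supported (S I : set) :=
  (exists x, I x /\ x != 0) /\
  exists L : seq set, forall T, base_point S I T ->
    exists2 T', Stdlib.Lists.List.In T' L & seteq T T'.

Definition iclos (S J : set) : set :=
  fun y => S y /\ exists (n : nat) (a : nat -> F), (0 < n)%N /\
    (forall i, (0 < i <= n)%N -> ipow S J i (a i)) /\
    y ^+ n + \sum_(1 <= i < n.+1) a i * y ^+ (n - i) = 0.

Definition int_closed (S J : set) := seteq (iclos S J) J.

Definition mchain (S N L : set) (r : nat) (f : nat -> set) :=
  seteq (f 0%N) N /\ seteq (f r) L /\ (forall i, (i <= r)%N -> is_ideal S (f i)) /\
  (forall i, (i < r)%N -> subset (f i) (f i.+1) /\ ~ subset (f i.+1) (f i)).

Definition length_eq (S N L : set) (c : nat) :=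
  (exists f, mchain S N L c f) /\ (forall r f, mchain S N L r f -> (r <= c)%N).

Definition mu_eq (S I : set) (c : nat) :=
  (exists g : seq F, size g = c /\ seteq I (gen S (fun x => x \in g))) /\
  (forall g : seq F, seteq I (gen S (fun x => x \in g)) -> (c <= size g)%N).

End CommAlg.

Definition Kfld (k : closedFieldType) (d : nat) := {fraction {mpoly k[d]}}.

Definition embK (k : closedFieldType) (d : nat) (p : {mpoly k[d]}) : Kfld k d :=
  FracField.tofrac p.

(* R = k[x_1..x_d]_M inside K: fractions p/q with q(0) != 0 *)
Definition locR (k : closedFieldType) (d : nat) : Kfld k d -> Prop :=
  fun y => exists p q : {mpoly k[d]}, q.@[fun _ => 0] != 0 /\ y = embK p / embK q.

Definition Mloc (k : closedFieldType) (d : nat) := maxid (@locR k d).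

Definition monomial_ideal (k : closedFieldType) (d : nat) (I : Kfld k d -> Prop) :=
  exists A : 'X_{1..d} -> Prop,
    seteq I (gen (@locR k d) (fun y => exists m, A m /\ y = embK ('X_[m] : {mpoly k[d]}))).

(* Main.v *)
From Stdlib Require Import ClassicalEpsilon FunctionalExtensionality PropExtensionality.
From mathcomp Require Import all_boot all_order all_algebra.
From mathcomp Require Import perm mpoly.
From mathcomp Require Import zify ring.
Require Import Defs.

(* Let [A] be the exponent set of [I] and [o] its least degree.  If no power of [x_i] lay
   in [I], all the origins of the successive charts [x_i] would be base points; if some
   pair [x_p, x_q] supported no monomial of degree [o] of [I], the points of the
   exceptional fibre on the line joining the two coordinate points would all be base
   points.  So finite support forces pure powers and, for each pair, such a monomial.

   The integral closure of [I] is spanned by the monomials of the Newton polyhedron, which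
   is the intersection of its analogues [newton_chart A i] on the charts of the blowing up
   of the origin.  By the edge monomials, an exponent [a] of degree at least [o] outside
   the polyhedron violates exactly one chart condition [i], and [a |-> a + e_i] is then a
   bijection onto the exponents of degree greater than [o] outside the polyhedron of [MI].
   Hence the two closures differ by as many monomials as there are monomials of degree
   [o].  Part (2) compares this with [mu(I) = l(I / MI)]. *)

Set Implicit Arguments.
Unset Strict Implicit.
Unset Printing Implicit Defensive.
Import Order.TTheory GRing.Theory Num.Theory.

(** The chart conditions are useful for two reasons. On the chart [x_i] the maximal ideal becomes
    principal, generated by [x_i], so the condition for [MI] at [a + e_i] is the condition for [I]
    at [a]. And the conditions at [p] and [q] cannot both fail in degree at least [o]: with the edge
    monomial [b] on [{p, q}], each failure gives an inequality, and since [b p + b q = o] the two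
    add up to [o * o > o * mdeg a]. The ideals are mere subsets of a field [F]. Every local ring
    that occurs is written [loc phi], with [phi] an injective morphism from the polynomial ring to
    the fixed [F]; blowing up only replaces [phi] by another such morphism, which permits induction
    along chains of quadratic transformations. Membership of a fraction in a monomial ideal is read
    off from the support of any numerator. Real convexity is avoided: a point of the polyhedron is
    an exponent some multiple [n * a] of which dominates a sum of [n] exponents. That such points
    are integral over [I] is a determinant trick; the converse uses Dickson's lemma in place of the
    closedness of the polyhedron. *)

Definition asb (P : Prop) : bool :=
  if excluded_middle_informative P then true else false.

Lemma asbP (P : Prop) : reflect P (asb P).
Proof. by rewrite /asb; case: excluded_middle_informative => h; constructor. Qed.

(** * The Newton polyhedron in integral form, and its charts *)

Section NewtonPolyhedron.
Variable d : nat.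
Local Notation mon := 'X_{1..d}.
Implicit Types (A B : mon -> Prop) (a b s t : mon).

Fixpoint nfold A (n : nat) : mon -> Prop :=
  if n is n'.+1 then fun s => exists a t, A a /\ nfold A n' t /\ s = (a + t)%MM
  else fun s => s = 0%MM.

(** Membership in the convex hull of [A] plus the positive orthant, with the denominators of a
    rational convex combination cleared. *)
Definition newton A a := exists n s,
  0 < n /\ nfold A n s /\ (s <= a *+ n)%MM.

(* Integral closure of [I] extended to the affine chart [k[x_i, x_j / x_i]] of the
   blowing up of the origin. *)
Definition newton_chart A (i : 'I_d) a := exists n s,
  0 < n /\ nfold A n s /\ mdeg s <= mdeg a * n /\
  forall j, j != i -> s j <= a j * n.

Definition shiftM A : mon -> Prop := fun s => exists a i, A a /\ s = (a + U_(i))%MM.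

Lemma lem_deg a b : (a <= b)%MM -> mdeg a <= mdeg b.
Proof. by move/mnm_lepP => h; rewrite !mdegE; apply: leq_sum => i _. Qed.

Lemma nfold1 A a : A a -> nfold A 1 a.
Proof. by move=> Aa; exists a, 0%MM; rewrite addm0. Qed.

Lemma nfoldD A m n s t : nfold A m s -> nfold A n t -> nfold A (m + n) (s + t)%MM.
Proof.
elim: m s => [|m IH] s /=; first by move=> ->; rewrite add0m.
move=> [a [u [Aa [hu ->]]]] ht; exists a, (u + t)%MM; split=> //.
by split; [apply: IH | rewrite addmA].
Qed.

Lemma nfoldMn A m s n : nfold A m s -> nfold A (m * n) (s *+ n)%MM.
Proof.
move=> h; elim: n => [|n IH]; first by rewrite muln0.
by rewrite mulnS mulmS; apply: nfoldD.
Qed.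

Lemma nfold_sum A (I : finType) (Q : pred I) (f : I -> mon) (n w : I -> nat) :
  (forall i, Q i -> nfold A (n i) (f i)) ->
  nfold A (\sum_(i | Q i) n i * w i) (\sum_(i | Q i) f i *+ w i)%MM.
Proof.
move=> h; elim/big_rec2: _ => // i y1 y2 Qi.
by apply: nfoldD; apply/nfoldMn/h.
Qed.

Lemma nfold_mono A B n s : (forall a, A a -> B a) -> nfold A n s -> nfold B n s.
Proof.
move=> h; elim: n s => //= n IH s [a [t [Aa [ht ->]]]].
by exists a, t; split; [apply: h|split; [apply: IH|]].
Qed.

Lemma nfold_deg A o n s : (forall a, A a -> o <= mdeg a) -> nfold A n s ->
  o * n <= mdeg s.
Proof.
move=> h; elim: n s => /= [|n IH] s; first by rewrite muln0.
by move=> [a [t [/h Aa [/IH ht ->]]]]; rewrite mdegD mulnS leq_add.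
Qed.

Lemma newton_deg A o a : (forall a, A a -> o <= mdeg a) -> newton A a -> o <= mdeg a.
Proof.
move=> hA [n [s [n0 [hs /lem_deg]]]]; rewrite mdegMn => le.
by have := nfold_deg hA hs; move=> /leq_trans/(_ le); rewrite leq_pmul2r.
Qed.

Lemma newton_up A a b : newton A a -> (a <= b)%MM -> newton A b.
Proof.
move=> [n [s [n0 [hs /mnm_lepP le]]]] /mnm_lepP ab; exists n, s.
split=> //; split=> //; apply/mnm_lepP => i; move: (le i) (ab i).
rewrite !mulmnE => h1 h2; nia.
Qed.

Lemma newton_mem A a b : A a -> (a <= b)%MM -> newton A b.
Proof. by move=> Aa ab; exists 1, a; split=> //; split=> //; apply: nfold1. Qed.

Lemma newton_newton_chart A i a : newton A a -> newton_chart A i a.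
Proof.
move=> [n [s [n0 [hs le]]]]; exists n, s; split=> //; split=> //.
split; first by rewrite -mdegMn lem_deg.
by move=> j _; rewrite -mulmnE; apply/mnm_lepP.
Qed.

(* [-D] is a singular M-matrix once its diagonal is lowered to make the row sums
   vanish; taking absolute values in a left kernel vector keeps the inequality. *)
Lemma newton_of_charts A a : 0 < d -> (forall i, newton_chart A i a) -> newton A a.
Proof.
move=> d0 /(@fin_all_exists _ _ _) [n hn].
have {hn} [s hs] := fin_all_exists hn.
pose E i j : int := ((a j * n i)%:Z - (s i j)%:Z)%R.
pose D : 'M[int]_d := (\matrix_(i, j)
  if i == j then - \sum_(l | l != i) E i l else E i j)%R.
have Doff i j : i != j -> (0 <= D i j)%R.
  rewrite mxE => ij; rewrite (negbTE ij) /E.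
  have [_ [_ [_ /(_ j)]]] := hs i; rewrite eq_sym ij => /(_ isT).
  by rewrite subr_ge0 lez_nat.
have Ddiag i : (D i i <= 0)%R.
  rewrite mxE eqxx oppr_le0; apply: sumr_ge0 => j ji.
  by have := Doff i j; rewrite mxE eq_sym (negbTE ji); apply.
have DE i j : (D i j <= E i j)%R.
  rewrite mxE; case: eqP => // <-.
  have [_ [_ [h _]]] := hs i.
  suff: (0 <= \sum_l E i l)%R by rewrite (bigD1 i) //= -lerBlDr sub0r.
  rewrite /E sumrB subr_ge0 -(big_morph Posz PoszD (erefl (Posz 0))).
  rewrite -(big_morph Posz PoszD (erefl (Posz 0))) lez_nat -mdegE -big_distrl /=.
  by rewrite -mdegE.
have detD : (\det D == 0)%R.
  rewrite -det_tr; apply/det0P; exists (const_mx 1)%R.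
    apply/eqP => /rowP /(_ (Ordinal d0)); rewrite !mxE => /eqP.
    by rewrite oner_eq0.
  apply/rowP => i; rewrite !mxE (bigD1 i) //= !mxE eqxx mul1r.
  rewrite addrC; apply/eqP; rewrite subr_eq0; apply/eqP/eq_bigr => l li.
  by rewrite !mxE mul1r eq_sym (negbTE li).
(* The matrix has integer entries, so the kernel vector is integral and its absolute values can
   serve as multiplicities in a sum of elements of [A]. *)
have [lam lam0 lamD] := det0P detD.
pose w i := `|lam 0%R i|%N.
have abs_ge0 j : (0 <= \sum_i `|lam 0 i|%:Z * D i j)%R.
  rewrite (bigD1 j) //=.
  have : (\sum_i lam 0 i * D i j == 0)%R.
    by have /rowP/(_ j) := lamD; rewrite mxE => ->; rewrite mxE.
  rewrite (bigD1 j) //=.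
  rewrite addr_eq0 => /eqP h.
  have : (`|lam 0 j * D j j| <= \sum_(i | i != j) `|lam 0 i|%:Z * D i j)%R.
    rewrite h normrN (le_trans (ler_norm_sum _ _ _)) //.
    apply: ler_sum => i ij; rewrite normrM (ger0_norm (Doff _ _ ij)).
    by rewrite abszE.
  by rewrite normrM (ler0_norm (Ddiag j)) mulrN lerNl -subr_ge0 opprK abszE.
have [i0 w0] : exists i0, 0 < w i0.
  apply/existsP; apply: contraNT lam0 => /existsPn h; apply/eqP/rowP => i.
  by apply/eqP; rewrite mxE -absz_eq0 -leqn0 leqNgt; apply: h.
exists (\sum_i n i * w i), (\sum_i s i *+ w i)%MM; split.
  rewrite (bigD1 i0) //= addn_gt0 muln_gt0 w0 andbT.
  by have [-> _] := hs i0.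
split; first by apply: nfold_sum => i _; have [_ [? _]] := hs i.
apply/mnm_lepP => j; rewrite mulmnE mnm_sumE -lez_nat.
rewrite big_distrr /= !(big_morph Posz PoszD (erefl (Posz 0))) -subr_ge0 -sumrB.
apply: le_trans (abs_ge0 j) _; apply: ler_sum => i _.
apply: le_trans (_ : (`|lam 0 i|%:Z * E i j <= _)%R).
  by apply: ler_wpM2l => //; apply: DE.
by rewrite /E /w mulmnE !PoszM; lia.
Qed.

End NewtonPolyhedron.

(** * Counting the exponents between the polyhedra of [I] and [MI] *)

Section NewtonCount.
Variable d : nat.
Local Notation mon := 'X_{1..d}.
Implicit Types (A : mon -> Prop) (a b s t : mon).

(* The property of [A] forced by finite support at the points of the exceptional
   fibre with exactly two non-zero coordinates. *)
Definition edge_property A o := forall p q : 'I_d, p != q ->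
  exists b, A b /\ mdeg b = o /\ forall r, r != p -> r != q -> b r = 0.

Lemma mdeg_edge b (p q : 'I_d) : p != q ->
  (forall r, r != p -> r != q -> b r = 0) -> mdeg b = b p + b q.
Proof.
move=> pq h; rewrite mdegE (bigD1 p) //= (bigD1 q) 1?eq_sym //= addnA big1 ?addn0 //.
by move=> r /andP[]; apply: h.
Qed.

(** Away from [p], coordinate [r] of the weighted sum of the [f r] comes from [f r] alone, so the
    chart condition splits into one inequality for each [r]. *)
Lemma newton_chart_combination A o (p : 'I_d) (f : 'I_d -> mon) (w : 'I_d -> nat) a :
  (forall r, r != p -> [/\ A (f r), mdeg (f r) = o &
     forall l, l != p -> l != r -> f r l = 0]) ->
  o <= mdeg a -> 0 < \sum_(r | r != p) w r ->
  (forall r, r != p -> w r * f r r <= a r * \sum_(r | r != p) w r) ->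
  newton_chart A p a.
Proof.
move=> hf oa w0 hw; exists (\sum_(r | r != p) w r), (\sum_(r | r != p) f r *+ w r)%MM.
split=> //; split.
  under eq_bigr do rewrite -[w _]mul1n.
  by apply: nfold_sum => r /hf[Ar _ _]; apply: nfold1.
split.
  rewrite mdeg_sum (eq_bigr (fun r => o * w r)) => [|r /hf[_ <- _]].
    by rewrite -big_distrr /= leq_mul2r oa orbT.
  by rewrite mdegMn.
move=> j jp; rewrite mnm_sumE (bigD1 j) //= big1 ?addn0 => [|r /andP[rp rj]].
  by rewrite mulmnE mulnC hw.
by have [_ _ h] := hf r rp; rewrite mulmnE h // eq_sym.
Qed.

Lemma edge_choice A o (p : 'I_d) : edge_property A o -> exists f : 'I_d -> mon,
  forall r, r != p -> [/\ A (f r), mdeg (f r) = o &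
     forall l, l != p -> l != r -> f r l = 0].
Proof.
move=> hB; apply: (@fin_all_exists _ _ (fun r b => r != p -> [/\ A b, mdeg b = o &
     forall l, l != p -> l != r -> b l = 0])) => r.
have [->|rp] := eqVneq r p; first by exists 0%MM.
have pr : p != r by rewrite eq_sym.
by have [b [Ab [ob hb]]] := hB p r pr; exists b.
Qed.

(** Weighting the edge monomial on [{i, r}] by [a r] works: the weights add up to [mdeg a] because
    [a i = 0], and no exponent of an edge monomial exceeds [o]. Hence an exponent that fails
    condition [i] can be lowered in direction [i]. *)
Lemma newton_chart_coord0 A o (i : 'I_d) a : 1 < d -> edge_property A o ->
  o <= mdeg a -> a i = 0 -> newton_chart A i a.
Proof.
move=> d2 hB oa ai0.
(* If [mdeg a = 0], all the weights would vanish; but then [o = 0] and an edge monomial is [1]. *)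
have [a0|a0] := posnP (mdeg a).
  have [j ij] : exists j : 'I_d, i != j.
    case: (eqVneq i (Ordinal d2)) => [->|?]; last by exists (Ordinal d2).
    by exists (Ordinal (ltnW d2)).
  have [b [Ab [ob _]]] := hB _ _ ij; move: oa; rewrite a0 leqn0 -ob mdeg_eq0 => /eqP b0.
  apply: newton_newton_chart; apply: newton_mem Ab _; rewrite b0.
  by apply/mnm_lepP => l; rewrite mnm0E.
have [f hf] := edge_choice i hB.
have sa : \sum_(r | r != i) a r = mdeg a by rewrite mdegE [RHS](bigD1 i) //= ai0.
apply: (newton_chart_combination (w := fun r => a r) hf) => //; first by rewrite sa.
move=> r ri; rewrite sa; have [_ h _] := hf r ri.
rewrite leq_mul2l (leq_trans _ oa) ?orbT // -h mdegE (bigD1 r) //=; exact: leq_addr.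
Qed.

(** Give [b] the weight [o * a q] and the edge monomial on [{p, r}] the weight [b q * a r]. The
    hypothesis says that the total weight is at least [o * b q], and with these weights this single
    bound yields the inequality of every coordinate. *)
Lemma newton_chart_weight A o (p q : 'I_d) b a : p != q -> edge_property A o ->
  A b -> mdeg b = o -> (forall r, r != p -> r != q -> b r = 0) ->
  o <= mdeg a ->
  o * b q <= o * a q + b q * \sum_(r | (r != p) && (r != q)) a r ->
  newton_chart A p a.
Proof.
move=> pq hB Ab ob hb oa le.
have qp : q != p by rewrite eq_sym.
have [bq0|bq0] := posnP (b q).
  exists 1, b; split=> //; split; first exact: nfold1.
  split; first by rewrite ob muln1.
  by move=> j jp; have [->|jq] := eqVneq j q; rewrite ?bq0 ?hb.
have [f hf] := edge_choice p hB.
pose g r := if r == q then b else f r.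
have hg r : r != p -> [/\ A (g r), mdeg (g r) = o &
    forall l, l != p -> l != r -> g r l = 0].
  by rewrite /g; have [-> _|_ /hf//] := eqVneq r q.
pose w r := if r == q then o * a q else b q * a r.
have sw : \sum_(r | r != p) w r =
    o * a q + b q * \sum_(r | (r != p) && (r != q)) a r.
  rewrite (bigD1 q) //= {1}/w eqxx big_distrr /=; congr addn.
  by apply: eq_bigr => r /andP[_ /negbTE rq]; rewrite /w rq.
have o0 : 0 < o by rewrite -ob mdegE (bigD1 q) //= ltn_addr.
apply: (newton_chart_combination (w := w) hg) => //; rewrite sw.
  by apply: leq_trans le; rewrite muln_gt0 o0.
move=> r rp; rewrite /w /g; have [->|rq] := eqVneq r q; first by nia.
have [_ h _] := hf r rp.
have : f r r <= o by rewrite -h mdegE (bigD1 r) //=; exact: leq_addr.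
move=> fo; apply: leq_trans (_ : a r * (o * b q) <= _); last by rewrite leq_mul2l le orbT.
by rewrite (mulnC (b q)) -mulnA leq_mul2l mulnC leq_mul2r fo !orbT.
Qed.

Lemma newton_chart_pair A o (p q : 'I_d) a : p != q -> edge_property A o ->
  o <= mdeg a -> newton_chart A p a \/ newton_chart A q a.
Proof.
move=> pq hB oa; have [b [Ab [ob hb]]] := hB _ _ pq.
have qp : q != p by rewrite eq_sym.
have hb' r : r != q -> r != p -> b r = 0 by move=> *; apply: hb.
set S := \sum_(r | (r != p) && (r != q)) a r.
have da : mdeg a = a p + a q + S by rewrite mdegE (bigD1 p) //= (bigD1 q) //= addnA.
have db := mdeg_edge pq hb.
have [le|le] := leqP (o * b q) (o * a q + b q * S).
  by left; apply: (newton_chart_weight pq hB Ab).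
right; apply: (newton_chart_weight qp hB Ab) => //.
rewrite (eq_bigl (fun r => (r != p) && (r != q))) => [|r]; last by rewrite andbC.
(* Subtracting the failed inequality for [q] from [o * o <= o * mdeg a] leaves
   [o * b p <= o * a p + b p * S], because [b p + b q = o]. *)
by rewrite -/S; nia.
Qed.

Lemma nfold_shiftM A n s : nfold (shiftM A) n s ->
  exists2 t, nfold A n t & (t <= s)%MM /\ mdeg s = mdeg t + n.
Proof.
elim: n s => /= [|n IH] s.
  by move=> ->; exists 0%MM => //; rewrite lepm_refl mdeg0.
move=> [_ [u [[a [i [Aa ->]]] [/IH[t ht [/mnm_lepP le eq]] ->]]]].
exists (a + t)%MM; first by exists a, t.
split; last by rewrite !mdegD mdeg1 eq; lia.
by apply/mnm_lepP => j; rewrite !mnmDE; have := le j; lia.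
Qed.

(** Dropping the [n] unit vectors of an [n]-fold sum lowers its degree by [n], and the degree is the
    only place where [U_(i)] enters condition [i]. Conversely all [n] unit vectors may be taken
    equal to [U_(i)]. *)
Lemma newton_chart_shiftM A i a :
  newton_chart (shiftM A) i (a + U_(i))%MM <-> newton_chart A i a.
Proof.
split=> [[n [s [n0 [/nfold_shiftM[t ht [/mnm_lepP le eq]] [sd sj]]]]]|].
  exists n, t; split=> //; split=> //; split.
    by move: sd; rewrite eq mdegD mdeg1; lia.
  move=> j ji; apply: leq_trans (le j) (leq_trans (sj j ji) _).
  by rewrite mnmDE mnm1E eq_sym (negbTE ji) addn0.
move=> [n [s [n0 [hs [sd sj]]]]]; exists n, (s + U_(i) *+ n)%MM; split=> //.
split.
  elim: n s hs {sd sj n0} => [|n IH] s /=; first by move=> ->; rewrite addm0.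
  move=> [b [t [Ab [ht ->]]]]; exists (b + U_(i))%MM, (t + U_(i) *+ n)%MM.
  split; [by exists b, i|split; [exact: IH|]].
  by apply/mnmP => j; rewrite !(mnmDE, mulmnE); lia.
split; first by rewrite !mdegD mdegMn mdeg1; lia.
move=> j ji; have := sj j ji; rewrite !mnmDE mulmnE mnm1E eq_sym (negbTE ji); lia.
Qed.

Lemma edge_shiftM A o : edge_property A o -> edge_property (shiftM A) o.+1.
Proof.
move=> hB p q pq; have [b [Ab [ob hb]]] := hB _ _ pq.
exists (b + U_(p))%MM; split; first by exists b, p.
split; first by rewrite mdegD mdeg1 ob addn1.
by move=> r rp rq; rewrite mnmDE hb // mnm1E eq_sym (negbTE rp).
Qed.

Lemma newton_shiftM A a : newton (shiftM A) a -> newton A a.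
Proof.
move=> [n [s [n0 [/nfold_shiftM[t ht [le _]] sa]]]]; exists n, t; split=> //.
by split=> //; apply: lepm_trans le sa.
Qed.

Definition mons_lt D : seq mon := [seq bmnm x | x : 'X_{1..d < D}].

Lemma mons_lt_uniq D : uniq (mons_lt D).
Proof. by rewrite map_inj_uniq ?enum_uniq //; exact: val_inj. Qed.

Lemma mem_mons_lt D a : (a \in mons_lt D) = (mdeg a < D).
Proof.
apply/imageP/idP => [[x _ ->]|h]; first exact: bmdeg.
by exists (BMultinom h).
Qed.

End NewtonCount.

Lemma count_mons_deg d D o : 0 < d -> o < D ->
  count (fun a => mdeg a == o) (mons_lt d D) = 'C(o + d - 1, d - 1).
Proof.
case: d => // d _ oD.
have -> : o + d.+1 - 1 = d + o by lia.
rewrite subn1 /= -card_ord_partitions -size_filter cardE.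
(* The binomial counts tuples with entries at most [o]; an exponent of degree [o] has no larger
   entry. *)
pose g (t : d.+1.-tuple 'I_o.+1) := [multinom (tnth t i : nat) | i < d.+1].
have g_inj : injective g.
  move=> t u /mnmP h; apply/eq_from_tnth => i; apply: val_inj.
  by have := h i; rewrite !mnmE.
have mg t : mdeg (g t) = \sum_(i <- t) i.
  by rewrite mdegE big_tuple; apply: eq_bigr => i _; rewrite mnmE.
rewrite -(size_map g); apply: perm_size; apply: uniq_perm.
- by rewrite filter_uniq ?mons_lt_uniq.
- by rewrite map_inj_uniq ?enum_uniq.
move=> a; rewrite mem_filter mem_mons_lt; apply/andP/mapP => [[/eqP ao _]|[t]].
  pose t := [tuple (inord (a i) : 'I_o.+1) | i < d.+1].
  have at_ : a = g t.
    apply/mnmP => i; rewrite mnmE tnth_mktuple inordK // ltnS -ao mdegE (bigD1 i) //=.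
    exact: leq_addr.
  by exists t => //; rewrite mem_enum inE -mg -at_ ao.
by rewrite mem_enum inE -mg => /eqP h ->; rewrite h.
Qed.

(** The complements of the polyhedra are counted, both being contained in the degrees below [D].
    Degrees below [o] contribute equally to both, and all of degree [o] lies outside the polyhedron
    of [MI]. What remains, degree at least [o] for [I] and greater than [o] for [MI], is matched by
    the bijection. *)
Lemma newton_count d (A : 'X_{1..d} -> Prop) o : 1 < d -> edge_property A o ->
  (forall a, A a -> o <= mdeg a) -> (exists D, forall a, D <= mdeg a -> newton (shiftM A) a) ->
  exists s, uniq s /\ size s = 'C(o + d - 1, d - 1) /\
    forall a, a \in s <-> newton A a /\ ~ newton (shiftM A) a.
Proof.
move=> d2 hB hA [D0 hD]; pose D := maxn D0 o.+1.
have d0 := ltnW d2.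
have {}hD a : D <= mdeg a -> newton (shiftM A) a.
  by move=> h; apply: hD; apply: leq_trans h; apply: leq_maxl.
have oD : o < D by apply: leq_maxr.
have hB' := edge_shiftM hB.
have hA' a : shiftM A a -> o.+1 <= mdeg a.
  by move=> [b [i [/hA Ab ->]]]; rewrite mdegD mdeg1 addn1 ltnS.
pose P a := asb (newton A a); pose P' a := asb (newton (shiftM A) a).
have P'P a : P' a -> P a by move=> /asbP h; apply/asbP; apply: newton_shiftM.
have P'D a : ~~ P' a -> mdeg a < D.
  by rewrite ltnNge; apply: contra => /hD h; apply/asbP.
have Po a : P a -> o <= mdeg a by move=> /asbP; apply: newton_deg.
have P'o a : P' a -> o < mdeg a by move=> /asbP; apply: newton_deg.
pose E := mons_lt d D.
exists [seq a <- E | P a && ~~ P' a]; split; first by rewrite filter_uniq ?mons_lt_uniq.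
split; last first.
  move=> a; rewrite mem_filter mem_mons_lt; split.
    by move=> /andP[/andP[/asbP ? /asbP ?] _].
  move=> [Pa nP'a]; have -> : P a by apply/asbP.
  by have h : ~~ P' a; [apply/asbP | rewrite h P'D].
pose u a := ~~ P a && (o <= mdeg a); pose u' a := ~~ P' a && (o < mdeg a).
suff uu : count u E = count u' E.
  rewrite size_filter -(count_mons_deg d0 oD) -/E.
  have e1 : count (predC P') E = count (fun a => mdeg a < o) E +
      count (fun a => mdeg a == o) E + count u' E.
    elim: (E) => //= a l ->; have := P'o a; rewrite /u'.
    by case: (P' a) => /= [/(_ isT)|_]; case: (ltngtP (mdeg a) o) => //=; lia.
  have e2 : count (predC P) E = count (fun a => mdeg a < o) E + count u E.
    elim: (E) => //= a l ->; have := Po a; rewrite /u.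
    by case: (P a) => /= [/(_ isT)|_]; case: (ltnP (mdeg a) o) => //=; lia.
  have e3 : count (predC P') E = count (predC P) E + count (fun a => P a && ~~ P' a) E.
    elim: (E) => //= a l ->; have := P'P a.
    by case: (P' a); case: (P a) => //=; do ?[by move=> /(_ isT) | by move=> _; lia].
  by apply: (@addnI (count (predC P) E)); rewrite -[LHS]e3 e1 e2 uu addnAC.
pose ix a := [pick i | ~~ asb (newton_chart A i a)].
have ixP a : u a -> exists2 i, ix a = Some i & ~ newton_chart A i a.
  move=> /andP[nPa _]; rewrite /ix; case: pickP => [i /asbP h|h]; first by exists i.
  case/asbP: nPa; apply: newton_of_charts => // i; apply/asbP.
  by apply: negbFE (h i).
pose f a := if ix a is Some i then (a + U_(i))%MM else a.
rewrite -!size_filter -(size_map f); apply: perm_size; apply: uniq_perm.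
- rewrite map_inj_in_uniq ?filter_uniq ?mons_lt_uniq // => a b.
  rewrite !mem_filter => /andP[ua _] /andP[ub _].
  have [i ia ni] := ixP _ ua; have [j jb nj] := ixP _ ub; rewrite /f ia jb.
  (* If [i != j], the common value [a + U_(i) = b + U_(j)] has degree greater than [o] and would
     fail the conditions [i] and [j] of [shiftM A] at once. *)
  move=> ab; have [ij|ij] := eqVneq i j.
    by move: ab; rewrite ij => /addIm.
  have oa : o < mdeg (a + U_(i))%MM.
    by rewrite mdegD mdeg1 addn1 ltnS; case/andP: ua.
  case: (newton_chart_pair ij hB' oa) => h.
    by case: ni; apply/newton_chart_shiftM.
  by case: nj; apply/newton_chart_shiftM; rewrite -ab.
- by rewrite filter_uniq ?mons_lt_uniq.
move=> b; rewrite mem_filter mem_mons_lt; apply/mapP/andP => [[a]|[/andP[nP'b ob] bD]].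
  rewrite mem_filter => /andP[ua _] ->; have [i ia ni] := ixP _ ua.
  have nP : ~~ P' (f a).
    rewrite /f ia; apply/asbP => /(newton_newton_chart i) h.
    by case: ni; apply/newton_chart_shiftM.
  split; last exact: P'D.
  by rewrite /u' nP /f ia mdegD mdeg1 addn1 ltnS; case/andP: ua.
have [i ni] : exists i, ~ newton_chart (shiftM A) i b.
  apply: NNPP => h; case/asbP: nP'b; apply: newton_of_charts => // i.
  by apply: NNPP => hi; apply: h; exists i.
have bi : 0 < b i.
  rewrite lt0n; apply/eqP => b0; apply: ni.
  exact: newton_chart_coord0 hB' _ _.
pose a := (b - U_(i))%MM.
have ba : b = (a + U_(i))%MM by rewrite submK // lep1mP -lt0n.
have nia : ~ newton_chart A i a by move=> h; apply: ni; rewrite ba; apply/newton_chart_shiftM.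
have ua : u a.
  apply/andP; split; last by move: ob; rewrite ba mdegD mdeg1 addn1 ltnS.
  by apply/asbP => /(newton_newton_chart i).
exists a; first by rewrite mem_filter ua mem_mons_lt (leq_ltn_trans _ bD) // ba mdegD leq_addr.
(* The index picked by [ix] is forced to be [i], since [a] cannot fail two chart conditions. *)
have [j ja nj] := ixP _ ua; rewrite /f ja; have [ij|ij] := eqVneq i j; first by rewrite -ij.
have oa : o <= mdeg a by case/andP: ua.
by case: (newton_chart_pair ij hB oa) => h.
Qed.

Local Open Scope ring_scope.

(** * Ideals of a subring of a field *)

Section IdealGeneralities.
Variable F : fieldType.
Implicit Types (S I J G : F -> Prop).

Lemma seteq_eq I J : seteq I J -> I = J.
Proof.
by move=> h; apply: functional_extensionality => x; apply: propositional_extensionality.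
Qed.

Lemma subset_eq I J : subset I J -> subset J I -> I = J.
Proof. by move=> h1 h2; apply: seteq_eq => x; split; [apply: h1|apply: h2]. Qed.

Lemma gen_sub S G : subset G (gen S G).
Proof. by move=> x Gx J _; apply. Qed.

Lemma gen_min S G J : is_ideal S J -> subset G J -> subset (gen S G) J.
Proof. by move=> hJ GJ x; apply. Qed.

Lemma subring_ideal S : subring S -> is_ideal S S.
Proof.
move=> [S0 [S1 [SB SM]]]; split=> //; split=> //; split=> // a b Sa Sb.
by rewrite -[b]opprK; apply: (SB) => //; rewrite -sub0r; apply: SB.
Qed.

Lemma gen_ideal S G : subring S -> subset G S -> is_ideal S (gen S G).
Proof.
move=> hS GS; split; first by apply: gen_min => //; apply: subring_ideal.
split; first by move=> J [_ [J0 _]].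
split; first by move=> a b ha hb J hJ GJ; have [_ [_ [JD _]]] := hJ; apply: JD; [apply: ha|apply: hb].
by move=> s a Ss ha J hJ GJ; have [_ [_ [_ JM]]] := hJ; apply: JM => //; apply: ha.
Qed.

Lemma ideal_sum S J (T : Type) (r : seq T) (P : pred T) (f : T -> F) :
  is_ideal S J -> (forall i, P i -> J (f i)) -> J (\sum_(i <- r | P i) f i).
Proof. by move=> [_ [J0 [JD _]]] h; elim/big_ind: _. Qed.

Lemma ideal_sum_seq S J (T : eqType) (r : seq T) (f : T -> F) :
  is_ideal S J -> (forall i, i \in r -> J (f i)) -> J (\sum_(i <- r) f i).
Proof. by move=> hJ h; rewrite big_seq_cond; apply: (ideal_sum _ hJ) => i; rewrite andbT; apply: h. Qed.

Lemma iprod_sub S I J : is_ideal S I -> is_ideal S J ->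
  subset (fun z => exists a b, I a /\ J b /\ z = a * b) S.
Proof.
move=> [IS _] [JS [_ [_ JM]]] z [a [b [Ia [Jb ->]]]].
by apply: JS; apply: JM => //; apply: IS.
Qed.

Lemma iprod_ideal S I J : subring S -> is_ideal S I -> is_ideal S J ->
  is_ideal S (iprod S I J).
Proof. by move=> hS hI hJ; apply: gen_ideal => //; apply: iprod_sub. Qed.

Lemma iprod_mul S I J a b : I a -> J b -> iprod S I J (a * b).
Proof. by move=> Ia Jb; apply: gen_sub; exists a, b. Qed.

Lemma ipow_ideal S I n : subring S -> is_ideal S I -> is_ideal S (ipow S I n).
Proof.
by move=> hS hI; elim: n => [|n IH] /=; [apply: subring_ideal|apply: iprod_ideal].
Qed.

Lemma ipow1 S I : subring S -> is_ideal S I -> ipow S I 1 = I.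
Proof.
move=> hS hI; apply: subset_eq => [|x Ix].
  apply: gen_min => // z [s [a [Ss [Ia ->]]]].
  by have [_ [_ [_ IM]]] := hI; apply: IM.
rewrite -[x]mul1r; apply: iprod_mul => //.
by have [_ [S1 _]] := hS.
Qed.

Lemma ideal_mulr S J a s : is_ideal S J -> J a -> S s -> J (a * s).
Proof. by move=> [_ [_ [_ JM]]] Ja Ss; rewrite mulrC; apply: JM. Qed.

Lemma ideal_opp S J a : subring S -> is_ideal S J -> J a -> J (- a).
Proof.
move=> [S0 [S1 [SB _]]] [_ [_ [_ JM]]] Ja; rewrite -mulN1r; apply: JM => //.
by rewrite -sub0r; apply: SB.
Qed.

Lemma ideal_sub S J a b : subring S -> is_ideal S J -> J a -> J b -> J (a - b).
Proof.
move=> hS hJ Ja Jb; have [_ [_ [JD _]]] := hJ; apply: JD => //.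
exact: ideal_opp hJ _.
Qed.

Lemma ideal_subD S J a b : subring S -> is_ideal S J -> J a -> J (a + b) -> J b.
Proof. by move=> hS hJ Ja Jab; rewrite -[b](addKr a) addrC; apply: ideal_sub hJ _ _. Qed.

End IdealGeneralities.

(** * Monomial ideals of the local ring at the origin *)

Section MonomialIdeals.
Variables (k F : fieldType) (d : nat) (phi : {rmorphism {mpoly k[d]} -> F}).
Hypothesis phi_inj : injective phi.
Local Notation mon := 'X_{1..d}.
Implicit Types (A B : mon -> Prop) (a b m : mon) (p q : {mpoly k[d]}).

(** The embedding [phi] is a parameter because the local rings of the blow-ups are again of this
    form, for other embeddings in the same field. *)
Definition loc : F -> Prop :=
  fun y => exists p q, q.@[fun _ => 0] != 0 /\ y = phi p / phi q.

Definition upc A : mon -> Prop := fun m => exists b, A b /\ (b <= m)%MM.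

Definition inM A : F -> Prop := fun y => exists p q,
  q@_0%MM != 0 /\ y = phi p / phi q /\ forall m, m \in msupp p -> upc A m.

Definition addS A B : mon -> Prop := fun s => exists a b, A a /\ B b /\ s = (a + b)%MM.

Definition Mset : mon -> Prop := fun m => exists i, m = U_(i)%MM.

Lemma mon_neq0 m : m != 0%MM -> exists i, m i != 0%N.
Proof.
move=> m0; apply/existsP; apply: contraNT m0 => /existsPn h; apply/eqP/mnmP => i.
by rewrite mnm0E; apply/eqP; rewrite -[_ == _]negbK; apply: h.
Qed.

Lemma meval0_mcoeff0 p : p.@[fun _ => 0] = p@_0%MM.
Proof.
rewrite mevalE; have [h|h] := boolP (0%MM \in msupp p).
  rewrite (bigD1_seq 0%MM) ?msupp_uniq //= [X in _ * X]big1 ?mulr1 => [|i _]; last by rewrite mnm0E.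
  rewrite [X in _ + X]big1 ?addr0 // => m m0.
  have [i mi] := mon_neq0 m0.
  by rewrite (bigD1 i) //= expr0n (negbTE mi) mul0r mulr0.
rewrite (memN_msupp_eq0 h) big_seq_cond big1 // => m /andP[hm _].
have m0 : m != 0%MM by apply: contraNneq h => <-.
have [i mi] := mon_neq0 m0.
by rewrite (bigD1 i) //= expr0n (negbTE mi) mul0r mulr0.
Qed.

Lemma locP y : loc y <-> exists p q, q@_0%MM != 0 /\ y = phi p / phi q.
Proof. by split=> -[p [q [h e]]]; exists p, q; move: h; rewrite meval0_mcoeff0. Qed.

Lemma mcoeff0M p q : (p * q)@_0%MM = p@_0%MM * q@_0%MM.
Proof. exact: (rmorphM (mcoeff 0%MM)). Qed.

Lemma phi_neq0 p : p != 0 -> phi p != 0.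
Proof. by apply: contraNneq => h; apply/eqP/phi_inj; rewrite h rmorph0. Qed.

Lemma denom_neq0 q : q@_0%MM != 0 -> q != 0.
Proof. by apply: contraNneq => ->; rewrite mcoeff0. Qed.

Lemma phi_denom q : q@_0%MM != 0 -> phi q != 0.
Proof. by move=> /denom_neq0/phi_neq0. Qed.

Lemma loc_poly p : loc (phi p).
Proof. by apply/locP; exists p, 1; rewrite mcoeff1 eqxx oner_eq0 rmorph1 divr1. Qed.

Lemma frac_add p1 q1 p2 q2 : q1@_0%MM != 0 -> q2@_0%MM != 0 ->
  phi p1 / phi q1 + phi p2 / phi q2 = phi (p1 * q2 + p2 * q1) / phi (q1 * q2).
Proof.
move=> h1 h2; rewrite rmorphD !rmorphM /=.
by field; rewrite !phi_denom.
Qed.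

Lemma loc_subring : subring loc.
Proof.
split; first by rewrite -(rmorph0 phi); apply: loc_poly.
split; first by rewrite -(rmorph1 phi); apply: loc_poly.
split=> a b /locP[p1 [q1 [h1 ->]]] /locP[p2 [q2 [h2 ->]]]; apply/locP.
  rewrite -mulNr -rmorphN frac_add //; eexists; eexists; split; last by [].
  by rewrite mcoeff0M mulf_neq0.
exists (p1 * p2), (q1 * q2); rewrite mcoeff0M mulf_neq0 //; split=> //.
by rewrite !rmorphM invfM; ring.
Qed.

Lemma loc_inv q : q@_0%MM != 0 -> loc (phi q)^-1.
Proof. by move=> h; apply/locP; exists 1, q; rewrite rmorph1 mul1r. Qed.

Lemma upc_sub A a : A a -> upc A a.
Proof. by move=> Aa; exists a; rewrite lepm_refl. Qed.

Lemma upc_le A a b : upc A a -> (a <= b)%MM -> upc A b.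
Proof. by move=> [c [Ac ca]] ab; exists c; split=> //; apply: lepm_trans ca ab. Qed.

Lemma upc_addr A a b : upc A a -> upc A (a + b)%MM.
Proof. by move=> h; apply: upc_le h _; apply: lem_addr. Qed.

Lemma msuppD_upc A p q : (forall m, m \in msupp p -> upc A m) ->
  (forall m, m \in msupp q -> upc A m) -> forall m, m \in msupp (p + q) -> upc A m.
Proof. by move=> h1 h2 m /msuppD_le; rewrite mem_cat => /orP[/h1|/h2]. Qed.

Lemma msuppM_upc A p q : (forall m, m \in msupp p -> upc A m) ->
  forall m, m \in msupp (p * q) -> upc A m.
Proof.
move=> h m /msuppM_le /allpairsP[[m1 m2] /= [/h h1 _ ->]]; exact: upc_addr.
Qed.

Lemma inM_ideal A : is_ideal loc (inM A).
Proof.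
split; first by move=> y [p [q [h [-> _]]]]; apply/locP; exists p, q.
split.
  exists 0, 1; rewrite mcoeff1 eqxx oner_eq0 rmorph0 mul0r; split=> //; split=> //.
  by move=> m; rewrite mcoeff_msupp mcoeff0 eqxx.
split.
  move=> a b [p1 [q1 [h1 [-> s1]]]] [p2 [q2 [h2 [-> s2]]]].
  rewrite frac_add //; exists (p1 * q2 + p2 * q1), (q1 * q2).
  split; [by rewrite mcoeff0M mulf_neq0 | split=> //].
  by apply: msuppD_upc; apply: msuppM_upc.
move=> s a /locP[p1 [q1 [h1 ->]]] [p2 [q2 [h2 [-> s2]]]].
exists (p2 * p1), (q2 * q1); rewrite mcoeff0M mulf_neq0 //; split=> //; split.
  by rewrite !rmorphM invfM; ring.
exact: msuppM_upc.
Qed.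

Lemma inM_poly A p : (forall m, m \in msupp p -> upc A m) -> inM A (phi p).
Proof. by move=> h; exists p, 1; rewrite mcoeff1 eqxx oner_eq0 rmorph1 divr1. Qed.

Lemma inM_mon A a : upc A a -> inM A (phi 'X_[a]).
Proof. by move=> h; apply: inM_poly => m; rewrite msuppX inE => /eqP ->. Qed.

(** Every other contribution to the coefficient of [m] would need a term of [p] strictly below [m].
    So a unit factor cannot remove a minimal term. *)
Lemma mcoeffM_minimal p q m : (forall b, (b <= m)%MM -> b != m -> p@_b = 0) ->
  (p * q)@_m = p@_m * q@_0%MM.
Proof.
move=> h; pose q' := q - (q@_0%MM)%:MP.
have e : p * q = (q@_0%MM)%:MP * p + p * q'.
  by rewrite /q' mulrBr [p * _%:MP]mulrC addrC subrK.
have q'0 : q'@_0%MM = 0 by rewrite mcoeffB mpolyCK subrr.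
rewrite e mcoeffD mcoeffCM mulrC [X in _ + X](_ : _ = 0) ?addr0 //.
apply/eqP; rewrite mcoeff_eq0; apply/negP => /msuppM_le /allpairsP[[m1 m2] /= [h1 h2 em]].
move: h1; rewrite mcoeff_msupp h ?eqxx // ?em ?lem_addr //.
apply: contraTneq h2 => h2; have -> : m2 = 0%MM.
  by apply: (@addmI _ m1); rewrite -h2 addm0.
by rewrite mcoeff_msupp q'0 eqxx.
Qed.

(** Cross-multiplication gives [p * q' = p' * q] with the right side supported in [upc A]. A term of
    [p] of least degree outside [upc A] would survive on the left, as [q'] has a non-zero constant
    term. *)
Lemma inM_num A p q : q@_0%MM != 0 -> inM A (phi p / phi q) ->
  forall m, m \in msupp p -> upc A m.
Proof.
move=> hq [p' [q' [hq' [e s']]]].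
have {}e : p * q' = p' * q.
  apply: phi_inj; rewrite !rmorphM; move/eqP: e.
  by rewrite eqr_div ?phi_denom // => /eqP.
move=> m; have [n] := ubnP (mdeg m); elim: n m => // n IH m; rewrite ltnS => mn hm.
apply: NNPP => nup.
have : (p * q')@_m != 0.
  rewrite mcoeffM_minimal => [|b bm nbm]; first by rewrite mulf_neq0 // -mcoeff_msupp.
  apply/eqP; rewrite mcoeff_eq0; apply/negP => hb; apply: nup.
  have /mnm_lepP le := bm.
  apply: upc_le (IH _ _ hb) bm; apply: leq_trans mn.
  have [i bi] : exists i, (b i < m i)%N.
    apply/existsP; apply: contraNT nbm => /existsPn h; apply/eqP/mnmP => i.
    by apply/eqP; rewrite eqn_leq le leqNgt; apply: h.
  rewrite !mdegE (bigD1 i) //= [X in (_ < X)%N](bigD1 i) //= -addSn.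
  by apply: leq_add => //; apply: leq_sum.
rewrite e -mcoeff_msupp => /(msuppM_upc s'); exact: nup.
Qed.

Lemma inM_phi A p : inM A (phi p) -> forall m, m \in msupp p -> upc A m.
Proof.
move=> h; apply: (@inM_num A p 1); first by rewrite mcoeff1 eqxx oner_eq0.
by rewrite rmorph1 divr1.
Qed.

Lemma inM_sub A B : (forall a, A a -> upc B a) -> subset (inM A) (inM B).
Proof.
move=> h y [p [q [hq [-> s]]]]; exists p, q; split=> //; split=> // m /s[a [/h Ba am]].
exact: upc_le am.
Qed.

Lemma inM_subP A B : subset (inM A) (inM B) -> forall a, A a -> upc B a.
Proof.
move=> h a Aa; apply: (@inM_phi _ 'X_[a]); last by rewrite msuppX inE.
by apply/h/inM_mon/upc_sub.
Qed.

Lemma inM_eq A B : (forall a, upc A a <-> upc B a) -> inM A = inM B.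
Proof. by move=> h; apply: subset_eq; apply: inM_sub => a /upc_sub/h. Qed.

Lemma inM_eqP A B : inM A = inM B -> forall a, upc A a <-> upc B a.
Proof.
move=> e a; split=> -[b [hb ba]]; apply: upc_le ba.
  by apply: inM_subP hb; rewrite e.
by apply: inM_subP hb; rewrite -e.
Qed.

Lemma gen_mons A : gen loc (fun y => exists m, A m /\ y = phi 'X_[m]) = inM A.
Proof.
apply: subset_eq.
  apply: gen_min; first exact: inM_ideal.
  by move=> y [m [Am ->]]; apply/inM_mon/upc_sub.
move=> y [p [q [hq [-> s]]]] J hJ GJ; rewrite [p]mpolyE rmorph_sum mulr_suml.
apply: (ideal_sum_seq hJ) => m /s[b [Ab bm]].
rewrite -mul_mpolyC -(submK bm) mpolyXD !rmorphM /=.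
rewrite mulrC !mulrA; have [_ [_ [_ JM]]] := hJ; apply: JM; last by apply: GJ; exists b.
have [_ [_ [_ SM]]] := loc_subring.
by apply: (SM); [apply: (SM); [exact: loc_inv | exact: loc_poly] | exact: loc_poly].
Qed.

Lemma inM_prod A B : iprod loc (inM A) (inM B) = inM (addS A B).
Proof.
apply: subset_eq.
  apply: gen_min; first exact: inM_ideal.
  move=> y [_ [_ [[p1 [q1 [h1 [-> s1]]]] [[p2 [q2 [h2 [-> s2]]]] ->]]]].
  exists (p1 * p2), (q1 * q2); rewrite mcoeff0M mulf_neq0 //; split=> //; split.
    by rewrite !rmorphM invfM; ring.
  move=> m /msuppM_le /allpairsP[[m1 m2] /= [/s1[a [Aa am]] /s2[b [Bb bm]] ->]].
  exists (a + b)%MM; split; first by exists a, b.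
  by apply/mnm_lepP => i; rewrite !mnmDE leq_add //; apply/mnm_lepP.
rewrite -gen_mons; apply: gen_min.
  apply: iprod_ideal; [exact: loc_subring|exact: inM_ideal|exact: inM_ideal].
move=> y [_ [[a [b [Aa [Bb ->]]]] ->]]; rewrite mpolyXD rmorphM.
by apply: iprod_mul; apply/inM_mon/upc_sub.
Qed.

Lemma ipow_inM A n : ipow loc (inM A) n = inM (nfold A n).
Proof.
elim: n => [|n IH] /=.
  apply: subset_eq; last by case: (inM_ideal (fun s => s = 0%MM)).
  move=> y /locP[p [q [h ->]]]; exists p, q; split=> //; split=> // m _.
  by exists 0%MM; split=> //; apply/mnm_lepP => i; rewrite mnm0E.
rewrite IH inM_prod; apply: inM_eq => a; split=> -[_ [[b [c [hb [hc ->]]]] le]].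
  by exists (c + b)%MM; split; [exists c, b|rewrite addmC].
by exists (c + b)%MM; split; [exists c, b|rewrite addmC].
Qed.

Lemma maxid_frac p q : q@_0%MM != 0 -> maxid loc (phi p / phi q) <-> p@_0%MM = 0.
Proof.
move=> hq; split=> [[_ h]|p0].
  apply/eqP; apply: contra_notT h => h; split.
    by rewrite mulf_neq0 ?invr_neq0 //; apply: phi_denom.
  by rewrite invf_div; apply/locP; exists q, p.
split; first by apply/locP; exists p, q.
move=> [x0 /locP[p' [q' [hq' e]]]].
have pn0 : phi p != 0 by apply: contraNneq x0 => ->; rewrite mul0r.
have : p * p' = q * q'.
  apply: phi_inj; rewrite !rmorphM; move/eqP: e; rewrite invf_div.
  by rewrite eqr_div ?(phi_denom hq') // => /eqP ->; rewrite mulrC.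
move=> /(congr1 (mcoeff 0%MM)); rewrite !mcoeff0M p0 mul0r => /esym/eqP.
by rewrite mulf_eq0 (negbTE hq) (negbTE hq').
Qed.

Lemma maxid_loc : maxid loc = inM Mset.
Proof.
apply: subset_eq => y.
  move=> h; have [/locP[p [q [hq e]]] _] := h; move: h; rewrite e => /(maxid_frac _ hq) p0.
  exists p, q; split=> //; split=> // m hm.
  have /mon_neq0[i mi] : m != 0%MM.
    by apply: contraTneq hm => ->; rewrite mcoeff_msupp p0 eqxx.
  by exists U_(i)%MM; rewrite lep1mP; split=> //; exists i.
move=> [p [q [hq [-> s]]]]; apply/maxid_frac => //.
apply/eqP; rewrite mcoeff_eq0; apply/negP => /s[_ [[i ->]]].
by rewrite lep1mP mnm0E.
Qed.

Lemma upc_Mset_pow n a : upc (nfold Mset n) a <-> (n <= mdeg a)%N.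
Proof.
split=> [[b [hb /lem_deg ba]]|].
  apply: leq_trans ba; rewrite -[n]mul1n; apply: nfold_deg hb => c [i ->].
  by rewrite mdeg1.
elim: n a => [|n IH] a; first by exists 0%MM; split=> //; apply/mnm_lepP => i; rewrite mnm0E.
move=> na; have /mon_neq0[i ai] : a != 0%MM by rewrite -mdeg_eq0 -lt0n (leq_trans _ na).
have e : a = (U_(i) + (a - U_(i)))%MM by rewrite addmC submK // lep1mP.
have /IH[b [hb ba]] : (n <= mdeg (a - U_(i))%MM)%N by move: na; rewrite {1}e mdegD mdeg1.
exists (U_(i) + b)%MM; split; first by exists U_(i)%MM, b; split=> //; exists i.
by rewrite e; apply/mnm_lepP => j; rewrite !(mnmDE j U_(i)%MM) leq_add2l; apply/mnm_lepP.
Qed.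

Lemma ord_inM A n : ord_eq loc (inM A) n <->
  (forall a, A a -> (n <= mdeg a)%N) /\ exists2 a, A a & mdeg a = n.
Proof.
rewrite /ord_eq maxid_loc !ipow_inM; split=> [[h1 h2]|[h1 [a Aa an]]].
  have {}h1 a : A a -> (n <= mdeg a)%N by move=> /(inM_subP h1)/upc_Mset_pow.
  split=> //; apply: NNPP => h; apply: h2; apply: inM_sub => a Aa; apply/upc_Mset_pow.
  by rewrite ltn_neqAle h1 // andbT; apply/eqP => e; apply: h; exists a.
split; first by apply: inM_sub => b /h1 hb; apply/upc_Mset_pow.
by move=> /inM_subP/(_ a Aa)/upc_Mset_pow; rewrite an ltnn.
Qed.

Lemma iprod_maxid A : iprod loc (maxid loc) (inM A) = inM (shiftM A).
Proof.
rewrite maxid_loc inM_prod; apply: inM_eq => a; split.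
  move=> [_ [[_ [b [[i ->] [Ab ->]]]] le]]; exists (b + U_(i))%MM.
  by split; [exists b, i|rewrite addmC].
move=> [_ [[b [i [Ab ->]]] le]]; exists (U_(i) + b)%MM; split; last by rewrite addmC.
by exists U_(i)%MM, b; split=> //; exists i.
Qed.

End MonomialIdeals.

(** * Lengths and numbers of generators *)

Lemma subspace_chain_dim (k : fieldType) (c r : nat) (V : nat -> 'rV[k]_c -> Prop) :
  (forall i, (i <= r)%N -> V i 0) ->
  (forall i u v, (i <= r)%N -> V i u -> V i v -> V i (u + v)) ->
  (forall i a v, (i <= r)%N -> V i v -> V i (a *: v)) ->
  (forall i v, (i < r)%N -> V i v -> V i.+1 v) ->
  (forall i, (i < r)%N -> exists v, V i.+1 v /\ ~ V i v) -> (r <= c)%N.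
Proof.
move=> V0 VD VZ Vinc Vstr.
have [v hv] : exists v : 'I_r -> 'rV[k]_c, forall i : 'I_r, V i.+1 (v i) /\ ~ V i (v i).
  by apply: (@fin_all_exists _ _ (fun (i : 'I_r) w => V i.+1 w /\ ~ V i w)) => i; apply: Vstr.
have Vle i j w : (i <= j)%N -> (j <= r)%N -> V i w -> V j w.
  elim: j => [|j IH]; first by rewrite leqn0 => /eqP ->.
  rewrite leq_eqVlt => /orP[/eqP -> //|ij jr Vw].
  by apply: Vinc => //; apply: IH => //; apply: ltnW.
(* A linear relation, solved for the row [i] of largest index with a non-zero coefficient, would put
   [v i] into [V i]. *)
suff : row_free (\matrix_i v i) by rewrite /row_free => /eqP <-; apply: rank_leq_col.
apply: inj_row_free => lam lam0; apply/eqP; apply: contraT => nz.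
have [i0 hi0] : exists i0, lam 0 i0 != 0.
  by apply/existsP; apply: contraNT nz => /existsPn h; apply/eqP/rowP => i; rewrite mxE; apply/eqP/negbNE/h.
case: (@arg_maxnP _ i0 (fun i => lam 0 i != 0) (fun i => i) hi0) => i hi imax.
have [_ []] := hv i.
have e : lam 0 i *: v i = - \sum_(j | j != i) lam 0 j *: v j.
  move: lam0; rewrite mulmx_sum_row (bigD1 i) //= rowK => /eqP; rewrite addr_eq0 => /eqP ->.
  by congr (- _); apply: eq_bigr => j _; rewrite rowK.
have -> : v i = - (lam 0 i)^-1 *: \sum_(j | j != i) lam 0 j *: v j.
  by rewrite scaleNr -scalerN -e scalerA mulVf // scale1r.
have ir : (i <= r)%N by apply: ltnW.
apply: (VZ) => //; elim/big_ind: _ => [||j ji]; [exact: V0|by move=> *; apply: VD|].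
have [->|lj] := eqVneq (lam 0 j) 0; first by rewrite scale0r; apply: V0.
have /= := imax j lj; rewrite leq_eqVlt => /orP[/eqP/val_inj e'|lt]; first by rewrite e' eqxx in ji.
by apply: VZ => //; have [h _] := hv j; apply: Vle h.
Qed.

Section LengthMu.
Variables (k F : fieldType) (d : nat) (phi : {rmorphism {mpoly k[d]} -> F}).
Hypothesis phi_inj : injective phi.
Local Notation mon := 'X_{1..d}.
Local Notation loc := (loc phi).
Local Notation inM := (inM phi).
Implicit Types (A B : mon -> Prop) (a b m : mon) (p q : {mpoly k[d]}).

Lemma mdeg_le_eq a b : (a <= b)%MM -> (mdeg b <= mdeg a)%N -> a = b.
Proof.
move=> ab; rewrite -{1}(submK ab) mdegD -[X in (_ <= X)%N]add0n leq_add2r leqn0 mdeg_eq0.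
by move=> /eqP e; rewrite -(submK ab) e add0m.
Qed.

(** The monomials of [s] are added in order of decreasing degree. Each step is strict: a new
    monomial is no multiple of an earlier one, which differs from it and has at least its degree. *)
Lemma monomial_chain A B (s : seq mon) :
  (forall b, B b -> upc A b) -> uniq s ->
  (forall a, a \in s <-> upc A a /\ ~ upc B a) ->
  exists f, mchain loc (inM B) (inM A) (size s) f.
Proof.
move=> BA us hs; pose t := sort (fun a b => (mdeg b <= mdeg a)%N) s.
have st : size t = size s by rewrite size_sort.
have tt' : pairwise (fun a b => (mdeg b <= mdeg a)%N) t.
  rewrite -sorted_pairwise ?sort_sorted // => [a b|b a c h1 h2]; first exact: leq_total.
  exact: leq_trans h2 h1.
pose C i m := B m \/ m \in take i t.
exists (fun i => inM (C i)); split.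
  move=> y; rewrite (inM_eq phi (A := C 0%N) (B := B)) // => a.
  by split=> -[b [hb ba]]; exists b; split=> //; [case: hb => //; rewrite take0|left].
split.
  move=> y; rewrite (inM_eq phi (B := A)) // => a.
  split=> [[b [[/BA[c [Ac cb]]|]]]|[b [Ab ba]]].
  - by move=> ba; exists c; split=> //; apply: lepm_trans cb ba.
  - by rewrite -st take_size mem_sort => /hs[bA _] ba; apply: upc_le bA ba.
  - have [[c [Bc cb]]|nB] := classic (upc B b).
      by exists c; split; [left|apply: lepm_trans cb ba].
    exists b; split=> //; right; rewrite -st take_size mem_sort; apply/hs.
    by split=> //; apply: upc_sub.
split; first by move=> i _; apply: inM_ideal.
move=> i il; split.
  apply: inM_sub => a [Ba|ai]; apply: upc_sub; [by left|right].
  by move: ai; rewrite !in_take_leq ?st // ?(ltnW il) // => /leq_trans; apply.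
move=> /(inM_subP phi_inj) h; have {h} : upc (C i) (nth 0%MM t i).
  by apply: h; right; rewrite in_take_leq ?st // index_uniq ?st ?sort_uniq.
have it : nth 0%MM t i \in s by rewrite -(mem_sort (fun a b => (mdeg b <= mdeg a)%N)) mem_nth ?st.
move=> [b [[Bb|bi] le]]; first by have /hs[_ []] := it; exists b.
move: (bi); rewrite in_take_leq ?st ?(ltnW il) // => bi'.
have bt : b \in t by apply: mem_take bi.
have db : (mdeg (nth 0%MM t i) <= mdeg b)%N.
  have /(pairwiseP 0%MM)/(_ (index b t) i) := tt'; rewrite nth_index // !inE index_mem st.
  exact.
by move: bi'; rewrite (mdeg_le_eq le db) index_uniq ?st ?sort_uniq // ltnn.
Qed.

(** The ideals of a chain pull back along [P] to subspaces of [k^(size s)]. The chain stays strict: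
    a new element may be multiplied by its denominator, and the numerator differs from its part on
    [s] by an element of [inM B], which lies in every ideal of the chain. *)
Lemma length_inM A B (s : seq mon) :
  (forall b, B b -> upc A b) -> uniq s ->
  (forall a, a \in s <-> upc A a /\ ~ upc B a) ->
  length_eq loc (inM B) (inM A) (size s).
Proof.
move=> BA us hs; split; first exact: monomial_chain.
move=> r f [/seteq_eq f0 [/seteq_eq fr [fid fstr]]].
have hS := loc_subring phi_inj.
pose P (v : 'rV[k]_(size s)) : {mpoly k[d]} := \sum_(j < size s) v 0 j *: 'X_[nth 0%MM s j].
have PD u v : P (u + v) = P u + P v.
  by rewrite /P -big_split /=; apply: eq_bigr => j _; rewrite mxE scalerDl.
have PZ (a : k) v : P (a *: v) = a *: P v.
  by rewrite /P scaler_sumr; apply: eq_bigr => j _; rewrite mxE scalerA.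
have fle i j : (i <= j)%N -> (j <= r)%N -> subset (f i) (f j).
  elim: j => [|j IH]; first by rewrite leqn0 => /eqP -> _ y.
  rewrite leq_eqVlt => /orP[/eqP -> _ y //|ij jr y fy].
  by have [h _] := fstr j jr; apply/h/IH => //; apply: ltnW.
apply: (@subspace_chain_dim _ (size s) r (fun i v => f i (phi (P v)))).
- move=> i ir; rewrite /P big1 => [|j _]; last by rewrite mxE scale0r.
  by rewrite rmorph0; have [_ [? _]] := fid i ir.
- by move=> i u v ir hu hv; rewrite PD rmorphD; have [_ [_ [h _]]] := fid i ir; apply: h.
- move=> i a v ir hv; rewrite PZ -mul_mpolyC rmorphM.
  by have [_ [_ [_ h]]] := fid i ir; apply: h => //; apply: loc_poly.
- by move=> i v ir; have [h _] := fstr i ir; apply: h.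
move=> i ir; have [_ h] := fstr i ir.
have [y [yi1 nyi]] : exists y, f i.+1 y /\ ~ f i y.
  apply: NNPP => h'; apply: h => y yi1; apply: NNPP => nyi; apply: h'; by exists y.
have : inM A y by rewrite -fr; apply: fle yi1.
move=> [p [q [hq [e sp]]]].
pose v : 'rV[k]_(size s) := \row_j p@_(nth 0%MM s j); exists v.
have hB : inM B (phi (p - P v)).
  apply: inM_poly => // m; have [ms|ms] := boolP (m \in s).
    rewrite mcoeff_msupp mcoeffB raddf_sum /=.
    have mi : (index m s < size s)%N by rewrite index_mem.
    rewrite (bigD1 (Ordinal mi)) //= mcoeffZ mcoeffX mxE /= nth_index // eqxx mulr1.
    rewrite big1 ?addr0 ?subrr ?eqxx // => j ji; rewrite mcoeffZ mcoeffX.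
    case: eqP => [e'|_]; last by rewrite mulr0.
    by case/eqP: ji; apply: val_inj; rewrite /= -e' index_uniq.
  move=> hm; have mp : m \in msupp p.
    move: hm; rewrite !mcoeff_msupp mcoeffB raddf_sum /= big1 ?subr0 // => j _.
    rewrite mcoeffZ mcoeffX; case: eqP => [e'|_]; last by rewrite mulr0.
    by move: ms; rewrite -e' mem_nth.
  apply: NNPP => nB; move/negP: ms; apply; apply/hs; split=> //; exact: sp.
have yq : phi p = phi q * y by rewrite e mulrC divfK // phi_denom.
have yq' : y = (phi q)^-1 * phi p by rewrite e mulrC.
have hB' j : (j <= r)%N -> f j (phi (p - P v)) by move=> jr; apply: (fle 0%N) => //; rewrite f0.
have pE : phi p = phi (p - P v) + phi (P v) by rewrite -rmorphD subrK.
split.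
  have hi := fid i.+1 ir; apply: (ideal_subD hS hi (hB' _ ir)); rewrite -pE yq.
  by have [_ [_ [_ hm]]] := hi; apply: hm => //; apply: loc_poly.
move=> hv; apply: nyi; rewrite yq' pE.
have [_ [_ [hd hm]]] := fid i (ltnW ir); apply: hm; first exact: loc_inv.
by apply: hd => //; apply: hB'; apply: ltnW.
Qed.

Lemma upc_shiftM A b m : upc A b -> (b <= m)%MM -> b != m -> upc (shiftM A) m.
Proof.
move=> [a [Aa ab]] bm nbm.
have /mon_neq0[i mi] : (m - b)%MM != 0%MM.
  by apply: contraNneq nbm => e; rewrite -(submK bm) e add0m.
exists (a + U_(i))%MM; split; first by exists a, i.
apply/mnm_lepP => j; rewrite mnmDE mnm1E; move/mnm_lepP/(_ j): ab; move/mnm_lepP/(_ j): bm.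
by move: mi; rewrite mnmBE => mi; have [<-|_] := eqVneq i j; lia.
Qed.

Lemma upc_minimal A (s : seq mon) :
  (forall a, a \in s <-> upc A a /\ ~ upc (shiftM A) a) ->
  forall a, upc A a -> upc (fun m => m \in s) a.
Proof.
move=> hs a; have [n] := ubnP (mdeg a); elim: n a => // n IH a; rewrite ltnS => an Aa.
have [[_ [[b [i [Ab ->]]] le]]|h] := classic (upc (shiftM A) a); last first.
  by apply: upc_sub; apply/hs.
have /IH h : (mdeg b < n)%N.
  by apply: leq_trans an; move/lem_deg: le; rewrite mdegD mdeg1 addn1.
by apply: upc_le (h (upc_sub Ab)) _; apply: lepm_trans le; apply: lem_addr.
Qed.

(** The set [s] is a basis of [I / MI] over [k]. For a generating list [g], [G j] holds the
    coordinates of the class of the [j]-th generator, and [J] collects the elements of [I] whose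
    class is a combination of these. As an ideal containing [g], [J] contains every monomial of [s],
    so the matrix [G] has a left inverse and at least [size s] rows. *)
Lemma mu_inM A (s : seq mon) : uniq s ->
  (forall a, a \in s <-> upc A a /\ ~ upc (shiftM A) a) -> mu_eq loc (inM A) (size s).
Proof.
move=> us hs; split.
  exists [seq phi 'X_[m] | m <- s]; rewrite size_map; split=> //.
  have -> : inM A = inM (fun m => m \in s).
    apply: inM_eq => a; split; first exact: upc_minimal.
    by move=> [b [/hs[Ab _] ba]]; apply: upc_le ba.
  rewrite -gen_mons //.
  suff -> : (fun y => exists m, m \in s /\ y = phi 'X_[m]) =
    (fun x => x \in [seq phi 'X_[m] | m <- s]) by [].
  by apply: seteq_eq => y; split=> [[m [ms ->]]|/mapP[m ms ->]]; [apply: map_f|exists m].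
move=> g /seteq_eq e; pose n := size g.
have minc p q m : m \in s -> (forall m, m \in msupp p -> upc A m) ->
    (p * q)@_m = p@_m * q@_0%MM.
  move=> /hs[_ nm] sp; apply: mcoeffM_minimal => b bm nbm; apply/eqP.
  by rewrite mcoeff_eq0; apply/negP => /sp hb; apply: nm; apply: upc_shiftM hb bm nbm.
have [pq hpq] : exists pq : 'I_n -> {mpoly k[d]} * {mpoly k[d]}, forall j,
    [/\ (pq j).2@_0%MM != 0, nth 0 g j = phi (pq j).1 / phi (pq j).2 &
    forall m, m \in msupp (pq j).1 -> upc A m].
  apply: (@fin_all_exists _ _ (fun (j : 'I_n) x => [/\ x.2@_0%MM != 0, nth 0 g j = phi x.1 / phi x.2 &
    forall m, m \in msupp x.1 -> upc A m])) => j.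
  have : inM A (nth 0 g j) by rewrite e; apply: gen_sub; rewrite mem_nth.
  by move=> [p [q [h1 [h2 h3]]]]; exists (p, q).
(* Modulo [MI] a denominator acts through its constant term. *)
pose G j m := (pq j).1@_m / (pq j).2@_0%MM.
pose J y := exists p q, [/\ q@_0%MM != 0, y = phi p / phi q,
  (forall m, m \in msupp p -> upc A m) &
  exists lam : 'I_n -> k, forall m, m \in s -> p@_m = q@_0%MM * \sum_j lam j * G j m].
have hJ : is_ideal loc J.
  split; first by move=> y [p [q [h1 -> _ _]]]; apply/locP; exists p, q.
  split.
    exists 0, 1; rewrite mcoeff1 eqxx oner_eq0 rmorph0 mul0r; split=> //.
      by move=> m; rewrite mcoeff_msupp mcoeff0 eqxx.
    exists (fun=> 0) => m _; rewrite mcoeff0 mul1r big1 // => j _; by rewrite mul0r.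
  split.
    move=> _ _ [p1 [q1 [h1 -> s1 [l1 hl1]]]] [p2 [q2 [h2 -> s2 [l2 hl2]]]].
    exists (p1 * q2 + p2 * q1), (q1 * q2); rewrite frac_add //; split=> //.
    - by rewrite mcoeff0M mulf_neq0.
    - by apply: msuppD_upc; apply: msuppM_upc.
    exists (fun j => l1 j + l2 j) => m ms; rewrite mcoeffD (minc _ _ _ ms s1) (minc _ _ _ ms s2).
    rewrite (hl1 _ ms) (hl2 _ ms) mcoeff0M.
    have -> : \sum_j (l1 j + l2 j) * G j m = \sum_j l1 j * G j m + \sum_j l2 j * G j m.
      by rewrite -big_split; apply: eq_bigr => j _; rewrite mulrDl.
    by ring.
  move=> _ _ /locP[u [v [hv ->]]] [p [q [hq -> sp [l hl]]]].
  exists (p * u), (q * v); split=> //.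
  - by rewrite mcoeff0M mulf_neq0.
  - by rewrite !rmorphM invfM; ring.
  - exact: msuppM_upc.
  exists (fun j => u@_0%MM / v@_0%MM * l j) => m ms; rewrite (minc _ _ _ ms sp) (hl _ ms) mcoeff0M.
  have -> : \sum_j u@_0%MM / v@_0%MM * l j * G j m =
      u@_0%MM / v@_0%MM * \sum_j l j * G j m.
    by rewrite mulr_sumr; apply: eq_bigr => j _; rewrite !mulrA.
  by field.
have AJ : subset (inM A) J.
  rewrite e; apply: gen_min => // y yg; have jn : (index y g < n)%N by rewrite index_mem.
  have [h1 h2 h3] := hpq (Ordinal jn); exists (pq (Ordinal jn)).1, (pq (Ordinal jn)).2.
  split=> //; first by rewrite -h2 /= nth_index.
  exists (fun j => (j == Ordinal jn)%:R) => m _; rewrite (bigD1 (Ordinal jn)) //= eqxx mul1r.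
  rewrite big1 ?addr0 => [|j /negbTE ->]; last by rewrite mul0r.
  by rewrite /G mulrC divfK.
have [lam hlam] : exists lam : 'I_(size s) -> 'I_n -> k, forall i : 'I_(size s),
    forall m, m \in s -> (nth 0%MM s i == m)%:R = \sum_j lam i j * G j m.
  apply: (@fin_all_exists _ _ (fun (i : 'I_(size s)) (l : 'I_n -> k) =>
    forall m, m \in s -> (nth 0%MM s i == m)%:R = \sum_j l j * G j m)) => i.
  have is_ : nth 0%MM s i \in s by rewrite mem_nth.
  have [iA niA] := (hs _).1 is_.
  have [p [q [hq e' sp [l hl]]]] : J (phi 'X_[nth 0%MM s i]) by apply/AJ/inM_mon.
  exists l => m ms; apply: (mulfI hq); rewrite -hl //.
  have <- : 'X_[nth 0%MM s i] * q = p.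
    by apply: (phi_inj); rewrite rmorphM e' divfK // phi_denom.
  rewrite minc // ?mcoeffX 1?mulrC // => m'; rewrite msuppX inE => /eqP -> //.
have : \matrix_(i < size s, j < n) lam i j *m \matrix_(j < n, i < size s) G j (nth 0%MM s i) = 1%:M.
  apply/matrixP => i i'; rewrite !mxE.
  rewrite (eq_bigr (fun j => lam i j * G j (nth 0%MM s i'))) => [|j _]; last by rewrite !mxE.
  by rewrite -hlam ?mem_nth // nth_uniq.
exact: mulmx1_min.
Qed.

End LengthMu.

(** * Dickson's lemma *)

Local Open Scope nat_scope.

Lemma monotone_subsequence (h : nat -> nat) : exists g : nat -> nat,
  (forall i, g i < g i.+1) /\ forall i, h (g i) <= h (g i.+1).
Proof.
have ex m : exists i, m <= i /\ forall j, m <= j -> h i <= h j.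
  suff: forall n i, h i < n -> m <= i -> exists i, m <= i /\ forall j, m <= j -> h i <= h j.
    by apply; [exact: (ltnSn (h m))|exact: leqnn].
  elim=> // n IH i; rewrite ltnS => hi mi.
  have [[j [mj hj]]|no] := classic (exists j, m <= j /\ h j < h i).
    by apply: (IH j) => //; apply: leq_trans hj hi.
  exists i; split=> // j mj; rewrite leqNgt; apply/negP => hj; apply: no; by exists j.
(* [nx m] is the place of a minimum of [h] on the tail from [m]; minima over shrinking tails can
   only grow. *)
pose nx m := sval (constructive_indefinite_description _ (ex m)).
have nxP m : m <= nx m /\ forall j, m <= j -> h (nx m) <= h j.
  by rewrite /nx; case: constructive_indefinite_description.
pose g := fix g i := if i is i'.+1 then nx (g i').+1 else nx 0.
exists g; split=> [i|i]; first by have [] := nxP (g i).+1.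
have gg : g i < g i.+1 by have [] := nxP (g i).+1.
by case: i gg => [|i] gg; [have [_] := nxP 0|have [_] := nxP (g i).+1]; apply => //;
  apply: ltnW; apply: leq_trans gg; have [] := nxP (g i).+1.
Qed.

Lemma increasing_le (g : nat -> nat) : (forall i, g i <= g i.+1) ->
  forall i j, i <= j -> g i <= g j.
Proof.
move=> h i j; elim: j => [|j IH]; first by rewrite leqn0 => /eqP ->.
by rewrite leq_eqVlt => /orP[/eqP -> //|/IH le]; apply: leq_trans le (h j).
Qed.

Lemma dickson (T : finType) (f : nat -> T -> nat) :
  exists i j, i < j /\ forall t, f i t <= f j t.
Proof.
suff [g [g1 g2]] : exists g : nat -> nat, (forall i, g i < g i.+1) /\
    forall t, t \in enum T -> forall i, f (g i) t <= f (g i.+1) t.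
  by exists (g 0), (g 1); split=> // t; apply: g2; rewrite mem_enum.
elim: (enum T) => [|t s [g [g1 g2]]]; first by exists id.
have [h [h1 h2]] := monotone_subsequence (fun i => f (g i) t).
have hle i : g (h i) < g (h i.+1).
  apply: leq_trans (g1 _) _; apply: increasing_le (h1 i) => j; exact: ltnW.
exists (g \o h); split=> // u; rewrite inE => /orP[/eqP -> //|us] i /=.
apply: (@increasing_le (fun i => f (g i) u)); last exact: ltnW.
by move=> j; apply: g2.
Qed.

(** * Finite generation and closedness of the polyhedron *)

Section FiniteGeneration.
Variable d : nat.
Local Notation mon := 'X_{1..d}.
Implicit Types (A B : mon -> Prop) (a b s t : mon).

(** The exponent form of the statement that [I] contains a power of the maximal ideal. *)
Definition has_pure_powers A := forall i : 'I_d, exists N, upc A (U_(i) *+ N)%MM.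

Lemma pure_powers_deg A : has_pure_powers A -> exists D, forall a, D <= mdeg a -> upc A a.
Proof.
move=> /(@fin_all_exists _ _ _) [N hN]; exists (\sum_i N i).+1 => a; rewrite mdegE => h.
have [i hi] : exists i, N i <= a i.
  apply/existsP; apply: contraTT h => /existsPn h; rewrite -leqNgt leq_sum // => i _.
  by apply: ltnW; rewrite ltnNge; apply: h.
apply: upc_le (hN i) _; apply/mnm_lepP => j; rewrite mulmnE mnm1E.
by case: eqP => [<-|_]; rewrite ?mul1n.
Qed.

Lemma pure_powers_mono A B : (forall a, A a -> upc B a) ->
  has_pure_powers A -> has_pure_powers B.
Proof.
move=> h hA i; have [N [a [Aa aN]]] := hA i; exists N; exact: upc_le (h a Aa) aN.
Qed.

Lemma pure_powers_nfold A n : has_pure_powers A -> has_pure_powers (nfold A n).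
Proof.
move=> hA i; have [N [a [Aa /mnm_lepP aN]]] := hA i; exists (N * n), (a *+ n)%MM; split.
  by rewrite -[n in nfold _ n]mul1n; apply/nfoldMn/nfold1.
apply/mnm_lepP => j; move: (aN j); rewrite !mulmnE mulnA => h.
by rewrite leq_mul2r h orbT.
Qed.

Lemma pure_powers_shiftM A : has_pure_powers A -> has_pure_powers (shiftM A).
Proof.
move=> hA i; have [N [a [Aa /mnm_lepP aN]]] := hA i; exists N.+1, (a + U_(i))%MM.
split; first by exists a, i.
by apply/mnm_lepP => j; have := aN j; rewrite mnmDE !mulmnE; lia.
Qed.

Lemma pure_powers_newton A : has_pure_powers A -> has_pure_powers (newton A).
Proof.
apply: pure_powers_mono => a Aa; apply/upc_sub; apply: newton_mem Aa _; exact: lepm_refl.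
Qed.

Lemma upc_newton A a : upc (newton A) a <-> newton A a.
Proof. by split=> [[b [hb ba]]|/upc_sub//]; apply: newton_up hb ba. Qed.

Lemma finite_generation A : has_pure_powers A -> exists G : seq mon,
  (forall g, g \in G -> A g) /\ forall a, upc A a -> exists2 g, g \in G & (g <= a)%MM.
Proof.
move=> /pure_powers_deg[D hD].
pose f a := if excluded_middle_informative (upc A a) is left h
  then sval (constructive_indefinite_description _ h) else a.
have fP a : upc A a -> A (f a) /\ (f a <= a)%MM.
  by move=> h; rewrite /f; case: excluded_middle_informative => // h'; case: constructive_indefinite_description.
exists [seq f a | a <- mons_lt d D.+1 & asb (upc A a)]; split.
  by move=> g /mapP[a]; rewrite mem_filter => /andP[/asbP h _] ->; have [] := fP a h.
move=> a ha.
have [b [hb ba bD]] : exists b, [/\ upc A b, (b <= a)%MM & mdeg b <= D].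
  have [aD|aD] := leqP (mdeg a) D; first by exists a; rewrite lepm_refl.
  have [b [hb ba]] := (upc_Mset_pow D a).2 (ltnW aD).
  have e : mdeg b = D.
    elim: (D) b hb {ba} => [|n IH] b /=; first by move=> ->; rewrite mdeg0.
    by move=> [_ [t [[i ->] [/IH ht ->]]]]; rewrite mdegD mdeg1 ht.
  by exists b; split; rewrite ?e //; apply: hD; rewrite e.
have [_ fb] := fP b hb; exists (f b); last exact: lepm_trans fb ba.
by apply: map_f; rewrite mem_filter mem_mons_lt ltnS bD andbT; apply/asbP.
Qed.

Lemma nfold_upc A B n s : (forall a, A a -> upc B a) -> nfold A n s -> upc (nfold B n) s.
Proof.
move=> h; elim: n s => [|n IH] s /=; first by move=> ->; apply: upc_sub.
move=> [a [t [/h[b [Bb /mnm_lepP ba]] [/IH[u [hu /mnm_lepP ut]] ->]]]].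
exists (b + u)%MM; split; first by exists b, u.
by apply/mnm_lepP => i; rewrite !mnmDE leq_add.
Qed.

Lemma nfold_coefs (G : seq mon) n s : nfold (fun m => m \in G) n s ->
  exists c : 'I_(size G) -> nat, \sum_i c i = n /\ s = (\sum_(i < size G) (nth 0%MM G i *+ c i))%MM.
Proof.
elim: n s => [|n IH] s /=.
  move=> ->; exists (fun=> 0); rewrite sum_nat_const muln0 big1 //.
move=> [a [t [aG [/IH[c [sc ->]] ->]]]].
have ia : index a G < size G by rewrite index_mem.
exists (fun i => c i + (i == Ordinal ia)); split.
  by rewrite big_split /= sc -addn1; congr (n + _); rewrite -big_mkcond /= big_pred1_eq.
apply/mnmP => j; rewrite mnmDE !mnm_sumE.
rewrite [RHS](eq_bigr (fun i : 'I_(size G) => (nth 0%MM G i *+ c i)%MM j + (i == Ordinal ia) * nth 0%MM G i j)).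
  rewrite big_split /= addnC; congr addn; rewrite (bigD1 (Ordinal ia)) //= eqxx mul1n nth_index //.
  by rewrite big1 ?addn0 // => i /negbTE ->.
by move=> i _; rewrite !mulmnE mulnDr [X in _ + X]mulnC.
Qed.

(** By Dickson's lemma the decompositions of [c + a *+ m] for two values [i < j] of [m] are
    comparable in all multiplicities and in the remainder. In their difference the shift [c]
    cancels, and [a *+ (j - i)] is a sum of [j - i] elements of [A] plus a remainder. *)
Lemma newton_closed A c a : has_pure_powers A ->
  (forall m, upc (nfold A m) (c + a *+ m)%MM) -> newton A a.
Proof.
move=> /finite_generation[G [GA AG]] h.
have {}h m : exists x : ('I_(size G) -> nat) * mon, \sum_i x.1 i = m /\
    (c + a *+ m = \sum_(i < size G) (nth 0%MM G i *+ x.1 i) + x.2)%MM.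
  have [s [hs sm]] := h m.
  have [t [/nfold_coefs[x [sx ->]] ts]] : upc (nfold (fun m => m \in G) m) s.
    apply: nfold_upc hs => b /upc_sub/AG[g gG gb]; by exists g.
  have le := lepm_trans ts sm.
  exists (x, (c + a *+ m - \sum_(i < size G) (nth 0%MM G i *+ x i))%MM); split=> //=.
  by rewrite [RHS]addmC submK.
pose x m := sval (constructive_indefinite_description _ (h m)).
have xP m : \sum_i (x m).1 i = m /\
    (c + a *+ m = \sum_(i < size G) (nth 0%MM G i *+ (x m).1 i) + (x m).2)%MM.
  by rewrite /x; case: constructive_indefinite_description.
pose f m (z : 'I_(size G) + 'I_d) := match z with inl i => (x m).1 i | inr l => (x m).2 l end.
have [i [j [ij fij]]] := dickson f.
have le1 l : (x i).1 l <= (x j).1 l by apply: (fij (inl l)).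
have le2 l : (x i).2 l <= (x j).2 l by apply: (fij (inr l)).
have [si ei] := xP i; have [sj ej] := xP j.
exists (j - i), (\sum_(l < size G) (nth 0%MM G l *+ ((x j).1 l - (x i).1 l)))%MM.
split; first by rewrite subn_gt0.
split.
  have -> : j - i = \sum_l 1 * ((x j).1 l - (x i).1 l).
    under eq_bigr do rewrite mul1n.
    by rewrite sumnB // sj si.
  by apply: nfold_sum => l _; apply/nfold1/GA/mem_nth.
apply/mnm_lepP => l; have /mnmP/(_ l) := ei; have /mnmP/(_ l) := ej.
rewrite !mnmDE !mulmnE !mnm_sumE.
under [in X in _ -> _ -> X <= _]eq_bigr do rewrite mulmnE mulnBr.
under eq_bigr do rewrite mulmnE.
under [X in _ -> _ = X + _ -> _]eq_bigr do rewrite mulmnE.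
rewrite sumnB => [|u _]; last by rewrite leq_mul2l le1 orbT.
have := le2 l; move: (\sum_l0 _) (\sum_l0 _) => S T; nia.
Qed.

(* Pigeonhole: a sum of [K.+1] generators of the Newton polyhedron repeats one of them
   often enough to be traded for elements of [A]. *)
Lemma newton_reduction A : has_pure_powers A -> exists K, forall s,
  nfold (newton A) K.+1 s -> upc (addS A (nfold (newton A) K)) s.
Proof.
move=> hA; have [G [GP PG]] := finite_generation (pure_powers_newton hA).
have AP a : A a -> newton A a by move=> Aa; apply: newton_mem Aa _; apply: lepm_refl.
have [n hn] : exists n : 'I_(size G) -> nat, forall i, exists s,
    0 < n i /\ nfold A (n i) s /\ (s <= nth 0%MM G i *+ n i)%MM.
  apply: (@fin_all_exists _ _ (fun (i : 'I_(size G)) (n : nat) => exists s,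
    0 < n /\ nfold A n s /\ (s <= nth 0%MM G i *+ n)%MM)) => i.
  by apply: GP; apply: mem_nth.
exists (\sum_i n i) => s hs.
have [t [/nfold_coefs[c [sc ->]] ts]] : upc (nfold (fun m => m \in G) (\sum_i n i).+1) s.
  by apply: nfold_upc hs => b /upc_sub/PG[g gG gb]; exists g.
apply: upc_le ts.
have [i hi] : exists i, n i < c i.
  apply/existsP; apply: contraPT sc => /existsPn h e.
  have : \sum_i c i <= \sum_i n i by apply: leq_sum => i _; rewrite leqNgt h.
  by rewrite e ltnn.
have [u [ni0 [hu uG]]] := hn i.
(* The [n i] copies of generator [i] dominate [u], a sum of [n i] elements of [A]. One of these is
   split off, and the other [n'] are kept as elements of the polyhedron. *)
move: (hn i) => _; case en : (n i) ni0 hu => [//|n'] _ /= [a [v [Aa [hv eu]]]].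
pose c' j := if j == i then c j - n i else c j.
have ec j : c j = c' j + (j == i) * n i by rewrite /c'; case: eqP => [->|_]; lia.
have sc' : \sum_j c' j + n i = (\sum_j n j).+1.
  rewrite -sc (eq_bigr (fun j => c' j + (j == i) * n i) (fun j _ => ec j)).
  rewrite big_split /=; congr addn; rewrite (bigD1 i) //= eqxx mul1n big1 ?addn0 //.
  by move=> j /negbTE ->.
exists (a + (v + \sum_(j < size G) (nth 0%MM G j *+ c' j)))%MM; split.
  exists a, (v + \sum_(j < size G) (nth 0%MM G j *+ c' j))%MM; split=> //; split=> //.
  have -> : \sum_j n j = n' + \sum_j 1 * c' j.
    by under [in RHS]eq_bigr do rewrite mul1n; move: sc'; rewrite en; lia.
  apply: nfoldD; first exact: nfold_mono hv.
  by apply: nfold_sum => j _; apply/nfold1/GP/mem_nth.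
apply/mnm_lepP => l; rewrite !mnmDE !mnm_sumE addnA -mnmDE -eu.
have /mnm_lepP/(_ l) := uG; rewrite mulmnE => le.
rewrite [X in _ <= X](eq_bigr (fun j : 'I_(size G) => (nth 0%MM G j *+ c' j)%MM l + (j == i) * (nth 0%MM G j l * n i))).
  rewrite big_split /= addnC leq_add2l (bigD1 i) //= eqxx mul1n big1 ?addn0 // => j /negbTE -> //.
by move=> j _; rewrite !mulmnE (ec j) mulnDr; congr addn; rewrite mulnCA.
Qed.

End FiniteGeneration.
Local Open Scope ring_scope.

(** * The integral closure and the Newton polyhedron *)

Section IntegralClosure.
Variables (k F : fieldType) (d : nat) (phi : {rmorphism {mpoly k[d]} -> F}).
Hypothesis phi_inj : injective phi.
Local Notation mon := 'X_{1..d}.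
Local Notation loc := (loc phi).
Local Notation inM := (inM phi).
Implicit Types (A B : mon -> Prop) (a b m : mon) (p q : {mpoly k[d]}).

Lemma inM_mul A B x y : inM A x -> inM B y -> inM (addS A B) (x * y).
Proof. by move=> hx hy; rewrite -inM_prod //; apply: iprod_mul. Qed.

Lemma inM_nfoldD A (m n : nat) x y : inM (nfold A m) x -> inM (nfold A n) y ->
  inM (nfold A (m + n)) (x * y).
Proof.
move=> hx hy; apply: inM_sub (inM_mul hx hy) => _ [s [t [hs [ht ->]]]].
by apply/upc_sub/nfoldD.
Qed.

Lemma nfold_split A (m n : nat) s : nfold A (m + n) s -> exists a b,
  nfold A m a /\ nfold A n b /\ s = (a + b)%MM.
Proof.
elim: m s => [|m IH] s /=; first by move=> h; exists 0%MM, s; rewrite add0m.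
move=> [a [t [Aa [/IH[b [c [hb [hc ->]]]] ->]]]]; exists (a + b)%MM, c.
by split; [exists a, b|split=> //; rewrite addmA].
Qed.

Lemma inM_nfold_le A (m n : nat) : (n <= m)%N -> subset (inM (nfold A m)) (inM (nfold A n)).
Proof.
move=> nm; apply: inM_sub => s; rewrite -(subnKC nm) => /nfold_split[a [b [ha [_ ->]]]].
by apply: upc_addr; apply: upc_sub.
Qed.

(** With [X] in degree one and [I ^ m] in degree [m], these polynomials have degree [n]. For [j > n]
    the truncated subtraction only asks for a coefficient in the ring. *)
Definition rees_poly A n (p : {poly F}) := forall j, inM (nfold A (n - j)) p`_j.

Lemma rees_polyM A (m n : nat) (p q : {poly F}) : rees_poly A m p -> rees_poly A n q ->
  rees_poly A (m + n) (p * q).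
Proof.
move=> hp hq j; rewrite coefM; apply: (ideal_sum _ (inM_ideal phi_inj _)) => i _.
apply: inM_nfold_le (inM_nfoldD (hp i) (hq (j - i)%N)).
by have := ltn_ord i; lia.
Qed.

Lemma rees_poly_prod A n (f : 'I_n -> {poly F}) : (forall i, rees_poly A 1 (f i)) ->
  rees_poly A n (\prod_i f i).
Proof.
elim: n f => [|n IH] f h.
  rewrite big_ord0 => j; rewrite sub0n coef1.
  rewrite -ipow_inM //=.
  have [S0 [S1 _]] := loc_subring phi_inj; by case: eqP.
by rewrite big_ord_recl; apply: (@rees_polyM _ 1 n) => //; apply: IH.
Qed.

(** The characteristic polynomial kills [y]. The entries of its matrix satisfy [rees_poly A 1], so
    the determinant satisfies [rees_poly A n]: the coefficient of [X ^ (n - i)] lies in [I ^ i], as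
    an integral equation requires. *)
Lemma det_trick A n (C : 'M[F]_n) (g : 'I_n -> F) y : (0 < n)%N -> loc y ->
  (forall i j, inM A (C i j)) -> (exists i, g i != 0) ->
  (forall i, y * g i = \sum_j C i j * g j) -> iclos loc (inM A) y.
Proof.
move=> n0 hy hC [i0 gi0] hg; split=> //.
(* Eigenvectors are row vectors in [eigenvalueP], hence the transpose. *)
pose p := char_poly C^T.
have root_p : root p y.
  rewrite -eigenvalue_root_char; apply/eigenvalueP; exists (\row_i g i).
    apply/rowP => i; rewrite !mxE hg; apply: eq_bigr => j _; rewrite !mxE; exact: mulrC.
  by apply: contraNneq gi0 => /rowP/(_ i0); rewrite !mxE => ->.
have sp : size p = n.+1 by rewrite size_char_poly.
have pn : p`_n = 1 by have := char_poly_monic C^T; rewrite monicE lead_coefE -/p sp => /eqP.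
have hp : rees_poly A n p.
  move=> j; rewrite /p /char_poly /determinant coef_sum.
  apply: (ideal_sum _ (inM_ideal phi_inj _)) => s _.
  have hprod : rees_poly A n (\prod_i char_poly_mx C^T i (s i)).
    apply: rees_poly_prod => i {}j; rewrite !mxE coefB coefMn coefX coefC.
    apply: (ideal_sub (loc_subring phi_inj) (inM_ideal phi_inj _)); last first.
      case: j => [|j] /=; last by have [_ [? _]] := inM_ideal phi_inj (nfold A (1 - j.+1)).
      apply: inM_sub (hC (s i) i) => a Aa; exact/upc_sub/nfold1.
    case: j => [|[|j]] /=; rewrite ?mul0rn.
    - by have [_ [? _]] := inM_ideal phi_inj (nfold A (1 - 0)).
    - have [S0 [S1 _]] := loc_subring phi_inj.
      by rewrite -[X in inM X _]/(nfold A 0) -ipow_inM //=; case: eqP.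
    by have [_ [? _]] := inM_ideal phi_inj (nfold A (1 - j.+2)).
  rewrite -signr_odd; case: (odd_perm s) => /=; rewrite ?expr1 ?expr0 ?mul1r //.
  by rewrite mulN1r coefN; apply: (ideal_opp (loc_subring phi_inj) (inM_ideal phi_inj _)).
exists n, (fun i => p`_(n - i)); split=> //; split.
  move=> i /andP[_ i_n]; rewrite ipow_inM //; have := hp (n - i)%N.
  by rewrite subKn.
move/rootP: root_p; rewrite horner_coef sp big_ord_recr /= pn mul1r addrC.
move=> h; rewrite -[RHS]h; congr (_ + _).
rewrite big_add1 /= -(big_mkord xpredT (fun j => p`_j * y ^+ j)) [RHS]big_nat_rev /=.
by rewrite add0n.
Qed.

(** Here [n] is the degree of an integral equation of [y]. For [m <= n] the factor [c] alone is in
    [I ^ m], and higher powers reduce by the equation. What matters is that the multiplier [c] is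
    independent of [m]. *)
Lemma iclos_power A y : iclos loc (inM A) y -> exists n, forall (m : nat) c,
  inM (nfold A n) c -> inM (nfold A m) (c * y ^+ m).
Proof.
move=> [hy [n [a [n0 [ha e]]]]]; exists n => m c hc.
have [l] := ubnP m; elim: l m => // l IH m; rewrite ltnS => ml.
have hS := loc_subring phi_inj.
have yX j : loc (y ^+ j).
  elim: j => [|j IHj]; first by have [_ [? _]] := hS.
  by rewrite exprS; have [_ [_ [_ h]]] := hS; apply: h.
have [mn|nm] := leqP m n.
  apply: inM_nfold_le mn _ _; rewrite mulrC.
  by have [_ [_ [_ h]]] := inM_ideal phi_inj (nfold A n); apply: h.
have ym : y ^+ m = - \sum_(1 <= i < n.+1) a i * y ^+ (m - i).
  have -> : y ^+ m = y ^+ n * y ^+ (m - n) by rewrite -exprD subnKC // ltnW.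
  move/eqP: e; rewrite addr_eq0 => /eqP ->; rewrite mulNr mulr_suml; congr (- _).
  rewrite !big_nat; apply: eq_bigr => i /andP[_ i_n]; rewrite -mulrA -exprD.
  by congr (_ * y ^+ _); lia.
rewrite ym mulrN mulr_sumr; apply: (ideal_opp hS (inM_ideal phi_inj _)).
rewrite big_nat; apply: (ideal_sum _ (inM_ideal phi_inj _)) => i /andP[i0 i_n].
have hm : (m - i < l)%N by lia.
have -> : c * (a i * y ^+ (m - i)) = a i * (c * y ^+ (m - i)) by ring.
have -> : m = (i + (m - i))%N by lia.
have -> : (i + (m - i) - i)%N = (m - i)%N by lia.
by apply: inM_nfoldD (IH _ hm); rewrite -ipow_inM //; apply: ha; rewrite i0.
Qed.

Lemma inM_addS_coefs A (G : seq mon) z : inM (addS A (fun m => m \in G)) z ->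
  exists c : 'I_(size G) -> F, (forall j, inM A (c j)) /\
    z = \sum_j c j * phi 'X_[nth 0%MM G j].
Proof.
rewrite -gen_mons // => /(_ (fun z => exists c : 'I_(size G) -> F,
  (forall j, inM A (c j)) /\ z = \sum_j c j * phi 'X_[nth 0%MM G j])); apply.
  have hI := inM_ideal phi_inj A; have [IS [I0 [ID IM]]] := hI.
  have hS := loc_subring phi_inj.
  split; first move=> _ [c [hc ->]].
    apply: (ideal_sum _ (subring_ideal hS)) => j _.
    have [_ [_ [_ h]]] := hS; apply: h; [exact/IS|exact: loc_poly].
  split; first by exists (fun=> 0); split=> //; rewrite big1 // => j _; rewrite mul0r.
  split.
    move=> _ _ [c [hc ->]] [c' [hc' ->]]; exists (fun j => c j + c' j).
    split; first by move=> j; apply: ID.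
    by rewrite -big_split; apply: eq_bigr => j _; rewrite mulrDl.
  move=> s _ hs [c [hc ->]]; exists (fun j => s * c j); split; first by move=> j; apply: IM.
  by rewrite mulr_sumr; apply: eq_bigr => j _; rewrite mulrA.
move=> _ [_ [[a [g [Aa [gG ->]]]] ->]].
have jn : (index g G < size G)%N by rewrite index_mem.
exists (fun j => if j == Ordinal jn then phi 'X_[a] else 0); split.
  move=> j; case: ifP => _; first by apply/inM_mon/upc_sub.
  by have [_ [? _]] := inM_ideal phi_inj A.
rewrite (bigD1 (Ordinal jn)) //= eqxx nth_index // big1 ?addr0 ?mpolyXD ?rmorphM //.
by move=> j /negbTE ->; rewrite mul0r.
Qed.

(** The [K] summands from the polyhedron are a reservoir: [y] adds one, and the [K.+1] are traded
    for an element of [A] and [K] again. Applied once this feeds the determinant trick; iterated, it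
    controls the powers of [y]. *)
Lemma inM_newton_step A K B y x : (forall s, nfold (newton A) K.+1 s ->
    upc (addS A (nfold (newton A) K)) s) ->
  inM (newton A) y -> inM (addS B (nfold (newton A) K)) x ->
  inM (addS (addS A B) (nfold (newton A) K)) (y * x).
Proof.
move=> hK hy hx; apply: inM_sub (inM_mul hy hx).
move=> _ [a [_ [Pa [[b [s [Bb [hs ->]]]] ->]]]].
have [_ [[c [t [Ac [ht ->]]]] le]] : upc (addS A (nfold (newton A) K)) (a + s)%MM.
  by apply: hK; exists a, s.
exists (c + b + t)%MM; split.
  by exists (c + b)%MM, t; split=> //; exists c, b.
apply/mnm_lepP => i; move/mnm_lepP/(_ i): le; rewrite !mnmDE; lia.
Qed.

Lemma newton_iclos A : (0 < d)%N -> has_pure_powers A ->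
  subset (inM (newton A)) (iclos loc (inM A)).
Proof.
move=> d0 hA y hy; have [K hK] := newton_reduction hA.
have [G [GP PG]] := finite_generation (pure_powers_nfold K (pure_powers_newton hA)).
have G0 : (0 < size G)%N.
  have [N [b [hb _]]] := pure_powers_nfold K (pure_powers_newton hA) (Ordinal d0).
  by have [g gG _] := PG b (upc_sub hb); rewrite -has_predT; apply/hasP; exists g.
have [C hC] : exists C : 'I_(size G) -> 'I_(size G) -> F, forall i,
    (forall j, inM A (C i j)) /\
    y * phi 'X_[nth 0%MM G i] = \sum_j C i j * phi 'X_[nth 0%MM G j].
  apply: (@fin_all_exists _ _ (fun (i : 'I_(size G)) (c : 'I_(size G) -> F) =>
    (forall j, inM A (c j)) /\
    y * phi 'X_[nth 0%MM G i] = \sum_j c j * phi 'X_[nth 0%MM G j])) => i.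
  apply: inM_addS_coefs.
  have hx : inM (addS (fun m => m = 0%MM) (nfold (newton A) K)) (phi 'X_[nth 0%MM G i]).
    apply/inM_mon/upc_sub; exists 0%MM, (nth 0%MM G i); rewrite add0m; split=> //.
    by split=> //; apply/GP/mem_nth.
  apply: inM_sub (inM_newton_step hK hy hx) => _ [_ [s [[a [_ [Aa [-> ->]]]] [hs ->]]]].
  have [g gG /mnm_lepP gs] := PG s (upc_sub hs); exists (a + g)%MM; split; first by exists a, g.
  by apply/mnm_lepP => j; rewrite !mnmDE mnm0E addn0 leq_add2l.
apply: (@det_trick A _ (\matrix_(i, j) C i j) (fun i => phi 'X_[nth 0%MM G i])) => //.
- by have [h _] := inM_ideal phi_inj (newton A); apply: h.
- by move=> i j; rewrite mxE; have [] := hC i.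
- exists (Ordinal G0); apply: phi_neq0 => //; apply/eqP => /(congr1 (mcoeff (nth 0%MM G 0))).
  by rewrite mcoeffX eqxx mcoeff0 => /eqP; rewrite oner_eq0.
by move=> i; have [_ ->] := hC i; apply: eq_bigr => j _; rewrite mxE.
Qed.

Lemma newton_power A y : (0 < d)%N -> has_pure_powers A -> inM (newton A) y ->
  exists t, forall m : nat, inM (nfold A m) (phi 'X_[t] * y ^+ m).
Proof.
move=> d0 hA hy; have [K hK] := newton_reduction hA.
have [N [t [ht _]]] := pure_powers_nfold K (pure_powers_newton hA) (Ordinal d0).
exists t => m; suff h : inM (addS (nfold A m) (nfold (newton A) K)) (phi 'X_[t] * y ^+ m).
  by apply: inM_sub h => _ [a [b [ha [_ ->]]]]; apply: upc_addr; apply: upc_sub.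
elim: m => [|m IH].
  by rewrite mulr1; apply/inM_mon/upc_sub; exists 0%MM, t; rewrite add0m.
by rewrite exprS mulrCA; apply: inM_newton_step hK hy IH.
Qed.

(** The numerator is split into its part [pP] on the polyhedron and the rest [pN]. If [pN] were
    non-zero, its [m]-th powers times a fixed monomial would lie in [I ^ m], and [newton_closed]
    would put its leading exponent into the polyhedron. *)
Lemma iclos_newton A : (0 < d)%N -> has_pure_powers A ->
  subset (iclos loc (inM A)) (inM (newton A)).
Proof.
move=> d0 hA y hy; have [/locP[p [q [hq e]]] _] := hy.
pose pP := \sum_(m <- msupp p | asb (newton A m)) p@_m *: 'X_[m].
have pPE m : pP@_m = if asb (newton A m) then p@_m else 0.
  rewrite /pP raddf_sum /=; have [h|h] := boolP (m \in msupp p); last first.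
    rewrite (memN_msupp_eq0 h) if_same big_seq_cond big1 // => m' /andP[hm' _].
    rewrite mcoeffZ mcoeffX; case: eqP => [em|_]; last by rewrite mulr0.
    by rewrite -em hm' in h.
  rewrite big_mkcond (bigD1_seq m) ?msupp_uniq //= big1 => [|m' nm]; last first.
    by case: ifP => // _; rewrite mcoeffZ mcoeffX (negbTE nm) mulr0.
  by rewrite addr0; case: ifP => // _; rewrite mcoeffZ mcoeffX eqxx mulr1.
have hpP : inM (newton A) (phi pP).
  apply: inM_poly => m; rewrite mcoeff_msupp pPE; case: asbP => [h _|]; last by rewrite eqxx.
  exact: upc_sub.
pose pN := p - pP.
have [pN0|nz] := eqVneq pN 0.
  have -> : y = (phi q)^-1 * phi pP.
    have ep : phi p = phi pP by congr (phi _); apply/eqP; rewrite -subr_eq0 -/pN pN0.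
    by rewrite e ep mulrC.
  have [_ [_ [_ h]]] := inM_ideal phi_inj (newton A); apply: h => //; exact: loc_inv.
exfalso; pose a := mlead pN.
have na : ~ newton A a.
  move=> ha; have : pN@_a != 0 by rewrite -mcoeff_msupp mlead_supp.
  rewrite mcoeffB pPE; case: asbP => // _; by rewrite subrr eqxx.
apply: na.
have [t ht] := newton_power d0 hA hpP.
have [n hn] := iclos_power hy.
have [u hu] : exists u, nfold A n u.
  have [N [b [Ab _]]] := hA (Ordinal d0); exists (b *+ n)%MM.
  by rewrite -[n in nfold _ n]mul1n; apply/nfoldMn/nfold1.
apply: (@newton_closed _ _ (u + t)%MM) => // m.
have hI := inM_ideal phi_inj (nfold A m); have [_ [_ [_ IM]]] := hI.
(* Expand the power of [pN = q * y - pP]: the monomial [u] takes care of the powers of [y], and [t]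
   of those of [pP]. *)
have hX : inM (nfold A m) (phi ('X_[u] * 'X_[t] * pN ^+ m)).
  rewrite rmorphM rmorphXn rmorphB exprBn mulr_sumr.
  apply: (ideal_sum _ hI) => i _; rewrite rmorphM.
  rewrite -mulr_natl.
  have -> : phi 'X_[u] * phi 'X_[t] *
      ('C(m, i)%:R * ((-1) ^+ i * phi p ^+ (m - i) * phi pP ^+ i)) =
    phi (('C(m, i)%:R) * (-1) ^+ i * q ^+ (m - i)) *
      (phi 'X_[u] * y ^+ (m - i) * (phi 'X_[t] * phi pP ^+ i)).
    rewrite !rmorphM rmorph_nat !rmorphXn rmorphN1.
    have -> : phi p = phi q * y by rewrite e mulrC divfK // phi_denom.
    by rewrite exprMn; ring.
  apply: IM; first exact: loc_poly.
  have := inM_nfoldD (hn (m - i)%N _ (inM_mon phi (upc_sub hu))) (ht i).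
  by rewrite subnK // -ltnS.
apply: (inM_phi phi_inj hX).
have XN0 (b : mon) : 'X_[b] != 0 :> {mpoly k[d]}.
  by apply/eqP => /(congr1 (mcoeff b)); rewrite mcoeffX eqxx mcoeff0 => /eqP; rewrite oner_eq0.
have -> : (u + t + a *+ m)%MM = mlead ('X_[u] * 'X_[t] * pN ^+ m).
  by rewrite !mleadM ?mulf_neq0 ?expf_neq0 // !mleadXm mleadX.
by rewrite mlead_supp // !mulf_neq0 ?expf_neq0.
Qed.

Lemma iclos_inM A : (0 < d)%N -> has_pure_powers A -> iclos loc (inM A) = inM (newton A).
Proof. by move=> d0 hA; apply: subset_eq; [apply: iclos_newton|apply: newton_iclos]. Qed.

End IntegralClosure.

(** * Induction on polynomials *)

Section PolynomialInduction.
Variables (k : fieldType) (d : nat).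

Lemma mpoly_ring_ind (P : {mpoly k[d]} -> Prop) :
  (forall a, P a%:MP) -> (forall i, P 'X_i) -> (forall p q, P p -> P q -> P (p + q)) ->
  (forall p q, P p -> P q -> P (p * q)) -> forall p, P p.
Proof.
move=> hC hX hD hM p; rewrite [p]mpolyE; elim/big_ind: _ => // [|m _].
  by rewrite -mpolyC0.
rewrite -mul_mpolyC; apply: (hM) => //; rewrite mpolyXE_id.
elim/big_ind: _ => // [|i _]; first by rewrite -mpolyC1.
by elim: (m i) => [|n IH]; [rewrite expr0 -mpolyC1|rewrite exprS; apply: hM].
Qed.

Lemma rmorph_mpoly_ext (S : nzRingType) (f g : {rmorphism {mpoly k[d]} -> S}) :
  (forall a, f a%:MP = g a%:MP) -> (forall i, f 'X_i = g 'X_i) -> f =1 g.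
Proof.
move=> hC hX; apply: mpoly_ring_ind => // p q hp hq.
  by rewrite !rmorphD hp hq.
by rewrite !rmorphM hp hq.
Qed.

End PolynomialInduction.

(** * Quadratic transformations in explicit coordinates *)

Section Blowup.
Variables (k F : fieldType) (d : nat) (phi : {rmorphism {mpoly k[d]} -> F}).
Hypothesis phi_inj : injective phi.
Variables (i : 'I_d) (c : 'I_d -> k).
Local Notation mon := 'X_{1..d}.
Implicit Types (A : mon -> Prop) (a b m : mon) (p q : {mpoly k[d]}).

Let x := phi 'X_i.

Definition blow_scalar : {rmorphism k -> F} :=
  GRing.RMorphism.clone _ _ (phi \o @mpolyC d k) _.

(* New coordinates at the point [c] of the chart [x_i <> 0] of the exceptional fibre:
   [x_i] and [x_j / x_i - c_j]. *)
Definition blow_coord (j : 'I_d) : F :=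
  if j == i then x else phi 'X_j / x - phi (c j)%:MP.

Definition blow : {rmorphism {mpoly k[d]} -> F} :=
  GRing.RMorphism.clone _ _ (mmap blow_scalar blow_coord) _.

(** This is [x_j / x_i] written in the new coordinates. *)
Definition blow_rest (j : 'I_d) : {mpoly k[d]} := if j == i then 1 else 'X_j + (c j)%:MP.

(* Old coordinates in terms of the new ones. *)
Definition blow_sub : {rmorphism {mpoly k[d]} -> {mpoly k[d]}} :=
  GRing.RMorphism.clone _ _ (mmap (@mpolyC d k) (fun j => 'X_i * blow_rest j)) _.

Lemma blowC (a : k) : blow a%:MP = phi a%:MP.
Proof. by rewrite /= mmapC. Qed.

Lemma blowXi : blow 'X_i = x.
Proof. by rewrite /= mmapX mmap1U /blow_coord eqxx. Qed.

Lemma blowXj j : j != i -> blow 'X_j = phi 'X_j / x - phi (c j)%:MP.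
Proof. by move=> ji; rewrite /= mmapX mmap1U /blow_coord (negbTE ji). Qed.

Lemma blow_subC (a : k) : blow_sub a%:MP = a%:MP.
Proof. by rewrite /= mmapC. Qed.

Lemma blow_subX j : blow_sub 'X_j = 'X_i * blow_rest j.
Proof. by rewrite /= mmapX mmap1U. Qed.

Lemma blow_subm m :
  blow_sub 'X_[m] = 'X_i ^+ mdeg m * \prod_j blow_rest j ^+ m j.
Proof.
rewrite /= mmapX /mmap1 mdegE -prodrXr -big_split /=.
by apply: eq_bigr => j _; rewrite exprMn.
Qed.

Lemma mon_x_neq0 m : ('X_[m] : {mpoly k[d]}) != 0.
Proof. by apply/eqP => /(congr1 (mcoeff m)); rewrite mcoeffX eqxx mcoeff0 => /eqP; rewrite oner_eq0. Qed.

Lemma x_neq0 : x != 0.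
Proof. by apply: phi_neq0 => //; apply: mon_x_neq0. Qed.

Lemma blow_blow_sub p : blow (blow_sub p) = phi p.
Proof.
apply: (@rmorph_mpoly_ext _ _ _ (GRing.RMorphism.clone _ _ (blow \o blow_sub) _) phi) => [a|j].
  by rewrite [LHS]/= [X in mmap _ _ X]blow_subC; apply: blowC.
rewrite -[LHS]/(blow (blow_sub 'X_j)) blow_subX rmorphM blowXi /blow_rest.
case: eqP => [->|/eqP ji]; first by rewrite rmorph1 mulr1.
by rewrite rmorphD blowXj // blowC subrK mulrC divfK // x_neq0.
Qed.

Lemma mcoeff0_blow_sub p : (blow_sub p)@_0%MM = p@_0%MM.
Proof.
apply: (@rmorph_mpoly_ext _ _ _ (GRing.RMorphism.clone _ _ (mcoeff 0%MM \o blow_sub) _)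
  (mcoeff 0%MM)) => [a|j].
  by rewrite -[LHS]/((blow_sub a%:MP)@_0%MM) blow_subC.
rewrite -[LHS]/((blow_sub 'X_j)@_0%MM) blow_subX mcoeff0M.
by rewrite [RHS]mcoeffX mcoeffX !mnm1_eq0 mul0r.
Qed.

Definition deg_ge n p := forall m, m \in msupp p -> (n <= mdeg m)%N.

Lemma deg_geM n1 n2 p q : deg_ge n1 p -> deg_ge n2 q -> deg_ge (n1 + n2) (p * q).
Proof.
move=> h1 h2 m /msuppM_le /allpairsP[[m1 m2] /= [/h1 e1 /h2 e2 ->]].
by rewrite mdegD leq_add.
Qed.

Lemma deg_geD n p q : deg_ge n p -> deg_ge n q -> deg_ge n (p + q).
Proof. by move=> h1 h2 m /msuppD_le; rewrite mem_cat => /orP[/h1|/h2]. Qed.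

Lemma deg_geX j n : deg_ge n ('X_j ^+ n).
Proof.
by rewrite mpolyXn => m; rewrite msuppX inE => /eqP ->; rewrite mdegMn mdeg1 mul1n.
Qed.

(** Denominators of a polynomial in the [x_j / x_i - c_j] are cleared by [x_i ^ N], and the result
    has order at least [N]; this is the form in which elements of the affine chart are given. *)
Lemma homogenize p : exists N q, blow_sub q = p * 'X_i ^+ N /\ deg_ge N q.
Proof.
elim/mpoly_ring_ind: p => [a|j|p1 p2 [N1 [q1 [e1 d1]]] [N2 [q2 [e2 d2]]]|
    p1 p2 [N1 [q1 [e1 d1]]] [N2 [q2 [e2 d2]]]].
- by exists 0%N, a%:MP; rewrite blow_subC mulr1.
- have [->|ji] := eqVneq j i.
    by exists 0%N, 'X_i; rewrite blow_subX /blow_rest eqxx !mulr1.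
  exists 1%N, ('X_j - (c j)%:MP * 'X_i); split.
    rewrite rmorphB rmorphM !blow_subX blow_subC /blow_rest eqxx (negbTE ji) expr1; ring.
  apply: deg_geD; first by rewrite -['X_j]expr1; apply: deg_geX.
  rewrite -mulNr -[1%N]add0n -['X_i]expr1; apply: deg_geM => //; exact: deg_geX.
- exists (N1 + N2)%N, (q1 * 'X_i ^+ N2 + q2 * 'X_i ^+ N1); split.
    rewrite rmorphD !rmorphM !rmorphXn blow_subX /blow_rest eqxx mulr1 e1 e2 exprD; ring.
  apply: deg_geD; last rewrite addnC; apply: deg_geM => //; exact: deg_geX.
exists (N1 + N2)%N, (q1 * q2); split; last exact: deg_geM.
by rewrite rmorphM e1 e2 exprD; ring.
Qed.

Lemma blow_inj : injective blow.
Proof.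
apply: raddf_inj => p bp0; have [N [q [e _]]] := homogenize p.
have q0 : q = 0 by apply: phi_inj; rewrite rmorph0 -blow_blow_sub e rmorphM bp0 mul0r.
move: e; rewrite q0 rmorph0 => /esym/eqP.
by rewrite mulf_eq0 expf_eq0 (negbTE (mon_x_neq0 _)) andbF orbF => /eqP.
Qed.

Lemma blow_sub_divisible n p : deg_ge n p -> exists p', blow_sub p = 'X_i ^+ n * p'.
Proof.
move=> h; rewrite [p]mpolyE rmorph_sum big_seq_cond.
elim/big_ind: _ => [|_ _ [p1 ->] [p2 ->]|m]; first by exists 0; rewrite mulr0.
  by exists (p1 + p2); rewrite mulrDr.
rewrite andbT => /h hm; rewrite -mul_mpolyC rmorphM blow_subC blow_subm -(subnKC hm) exprD.
exists ((p@_m)%:MP * ('X_i ^+ (mdeg m - n) * \prod_j blow_rest j ^+ m j)); ring.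
Qed.

Lemma maxid_pow n y : ipow (loc phi) (maxid (loc phi)) n y <->
  exists p q, [/\ q@_0%MM != 0, y = phi p / phi q & deg_ge n p].
Proof.
rewrite maxid_loc // ipow_inM //; split=> -[p [q]].
  by move=> [hq [e s]]; exists p, q; split=> // m /s /upc_Mset_pow.
by move=> [hq e s]; exists p, q; split=> //; split=> // m /s /upc_Mset_pow.
Qed.

Lemma chart_blow p : chart (loc phi) x (blow p).
Proof.
have [N [q [e dq]]] := homogenize p; exists N, (phi q); split.
  by apply/maxid_pow; exists q, 1; rewrite mcoeff1 eqxx oner_eq0 rmorph1 divr1.
by rewrite -blow_blow_sub e rmorphM rmorphXn blowXi mulfK // expf_neq0 // x_neq0.
Qed.

Lemma chart_sub : subset (chart (loc phi) x) (loc blow).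
Proof.
move=> _ [n [_ [/maxid_pow[p [q [hq -> dp]]] ->]]]; apply/locP.
have [p' e] := blow_sub_divisible dp; exists p', (blow_sub q).
rewrite mcoeff0_blow_sub; split=> //.
rewrite -!blow_blow_sub e rmorphM rmorphXn blowXi.
by rewrite mulrAC [_ * blow p']mulrC mulfK // expf_neq0 // x_neq0.
Qed.

Lemma chart_add y z : chart (loc phi) x y -> chart (loc phi) x z -> chart (loc phi) x (y + z).
Proof.
move=> [n1 [_ [/maxid_pow[p1 [q1 [h1 -> d1]]] ->]]] [n2 [_ [/maxid_pow[p2 [q2 [h2 -> d2]]] ->]]].
exists (n1 + n2)%N, (phi (p1 * 'X_i ^+ n2 * q2 + p2 * 'X_i ^+ n1 * q1) / phi (q1 * q2)).
split.
  apply/maxid_pow; exists (p1 * 'X_i ^+ n2 * q2 + p2 * 'X_i ^+ n1 * q1), (q1 * q2).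
  split=> //; first by rewrite mcoeff0M mulf_neq0.
  by apply: deg_geD; [|rewrite addnC]; rewrite -[(_ + _)%N]addn0; apply: deg_geM => //;
    apply: deg_geM => //; apply: deg_geX.
rewrite rmorphD !rmorphM !rmorphXn exprD -/x.
have := expf_neq0 n1 x_neq0; have := expf_neq0 n2 x_neq0.
have := phi_denom phi_inj h1; have := phi_denom phi_inj h2.
move: (x ^+ n1) (x ^+ n2) (phi p1) (phi p2) (phi q1) (phi q2) => y1 y2 P1 P2 Q1 Q2.
by move=> *; field; apply/and4P; split.
Qed.

Lemma chart_mul y z : chart (loc phi) x y -> chart (loc phi) x z -> chart (loc phi) x (y * z).
Proof.
move=> [n1 [_ [/maxid_pow[p1 [q1 [h1 -> d1]]] ->]]] [n2 [_ [/maxid_pow[p2 [q2 [h2 -> d2]]] ->]]].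
exists (n1 + n2)%N, (phi (p1 * p2) / phi (q1 * q2)).
split.
  apply/maxid_pow; exists (p1 * p2), (q1 * q2).
  by split=> //; [rewrite mcoeff0M mulf_neq0|apply: deg_geM].
by rewrite !rmorphM exprD !mulf_div.
Qed.

Lemma loc_chart : subset (loc phi) (chart (loc phi) x).
Proof. by move=> y hy; exists 0%N, y; rewrite expr0 divr1. Qed.

Lemma maxid_blow_inM : maxid (loc blow) = inM blow (@Mset d).
Proof. exact: maxid_loc blow_inj. Qed.

Lemma maxid_mul_x y : maxid (loc phi) y -> exists2 z, loc blow z & y = x * z.
Proof.
move=> my; have hM : is_ideal (loc phi) (maxid (loc phi)).
  by rewrite maxid_loc //; apply: inM_ideal.
exists (y / x); last by rewrite mulrC divfK // x_neq0.
by apply: chart_sub; exists 1%N, y; rewrite (ipow1 (loc_subring phi_inj)).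
Qed.

Lemma maxid_mulr y z : maxid (loc blow) y -> loc blow z -> maxid (loc blow) (y * z).
Proof. by rewrite maxid_blow_inM; apply: (ideal_mulr (inM_ideal blow_inj _)). Qed.

Lemma maxid_poly p : maxid (loc blow) (blow p) <-> p@_0%MM = 0.
Proof.
have -> : blow p = blow p / blow 1 by rewrite rmorph1 divr1.
by apply: (maxid_frac blow_inj); rewrite mcoeff1 eqxx oner_eq0.
Qed.

Lemma maxid_x : maxid (loc blow) x.
Proof. by rewrite -blowXi; apply/maxid_poly; rewrite mcoeffX mnm1_eq0. Qed.

Lemma blow_quad_transform : quad_transform (loc phi) (loc blow).
Proof.
have hM : is_ideal (loc blow) (maxid (loc blow)).
  by rewrite maxid_blow_inM; apply: inM_ideal blow_inj _.
have [MS [M0 [MD MM]]] := hM.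
(* The point is given by the contraction to the chart of the maximal ideal of [loc blow]. *)
exists x, (fun y => chart (loc phi) x y /\ maxid (loc blow) y).
split; first by rewrite maxid_loc //; apply/inM_mon/upc_sub; exists i.
split; first exact: x_neq0.
split.
  split; last split; first split; [by move=> y []| | |].
  - split; first by split=> //; rewrite -(rmorph0 blow); apply: chart_blow.
    split; first by move=> a b [ca ma] [cb mb]; split; [apply: chart_add|apply: MD].
    move=> s a cs [ca ma]; split; first exact: chart_mul.
    by apply: MM => //; apply: chart_sub.
  - rewrite -(rmorph1 blow) => -[_ /maxid_poly]; rewrite mcoeff1 eqxx.
    by move/eqP; rewrite oner_eq0.
  move=> a b ca cb [_ mab].
  have /locP[p1 [q1 [h1 e1]]] := chart_sub ca; have /locP[p2 [q2 [h2 e2]]] := chart_sub cb.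
  have : (p1 * p2)@_0%MM = 0.
    apply/(maxid_frac blow_inj (p1 * p2) (q := q1 * q2)); first by rewrite mcoeff0M mulf_neq0.
    by move: mab; rewrite e1 e2 !rmorphM mulf_div.
  rewrite mcoeff0M => /eqP; rewrite mulf_eq0 => /orP[] /eqP h; [left|right]; split=> //.
    by rewrite e1; apply/(maxid_frac blow_inj).
  by rewrite e2; apply/(maxid_frac blow_inj).
split.
  move=> y my; split; first by have [ly _] := my; apply: loc_chart.
  by have [z lz ->] := maxid_mul_x my; apply: maxid_mulr maxid_x lz.
move=> y; split.
  move=> /locP[p [q [hq ->]]]; exists (blow p), (blow q); split; first exact: chart_blow.
  split; first exact: chart_blow.
  split=> //; move=> [_ /maxid_poly q0]; by rewrite q0 eqxx in hq.
move=> [u [v [cu [cv [nv ->]]]]].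
have [_ [_ [_ SM]]] := loc_subring blow_inj.
apply: SM; first exact: chart_sub.
have [_ //] : v != 0 /\ loc blow v^-1.
by apply: NNPP => h; apply: nv; split=> //; split=> //; apply: chart_sub.
Qed.

Definition blow_gens A o : F -> Prop := fun y => exists a, A a /\ y = phi 'X_[a] / x ^+ o.

Lemma blow_genE a o : (o <= mdeg a)%N ->
  phi 'X_[a] / x ^+ o = blow ('X_i ^+ (mdeg a - o) * \prod_j blow_rest j ^+ a j).
Proof.
move=> oa; rewrite -blow_blow_sub blow_subm -{1}(subnKC oa) exprD -mulrA rmorphM.
by rewrite rmorphXn blowXi mulrC mulKf // expf_neq0 // x_neq0.
Qed.

(** Each element of [M] is a multiple of [x_i] in the new ring, so [M ^ o] extends to the principal
    ideal of [x_i ^ o], and the transform is generated by the old monomials divided by [x_i ^ o]. *)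
Lemma blow_is_transform A o : ord_eq (loc phi) (inM phi A) o ->
  is_transform (loc phi) (inM phi A) (loc blow) (gen (loc blow) (blow_gens A o)).
Proof.
move=> ho; have [hA _] := (ord_inM phi_inj A o).1 ho.
have hS := loc_subring blow_inj; have [_ [_ [_ SM]]] := hS.
have gS : subset (blow_gens A o) (loc blow).
  by move=> _ [a [/hA oa ->]]; rewrite blow_genE //; apply: loc_poly.
pose G y := exists m, A m /\ y = phi 'X_[m].
have loc_le : subset (loc phi) (loc blow) by move=> y /loc_chart; apply: chart_sub.
have GS : subset G (loc blow) by move=> _ [a [_ ->]]; apply/loc_le/loc_poly.
have hG := gen_ideal hS GS; have [_ [G0 [GD GM]]] := hG.
exists o; split=> //; split; first exact: gen_ideal.
suff e : gen (loc blow) (inM phi A) =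
   iprod (loc blow) (ipow (loc blow) (gen (loc blow) (maxid (loc phi))) o)
     (gen (loc blow) (blow_gens A o)) by rewrite e.
have mS : subset (maxid (loc phi)) (loc blow) by move=> y [/loc_le].
have hmm := gen_ideal hS mS.
transitivity (gen (loc blow) G).
  apply: subset_eq; apply: gen_min; last 1 first.
  - by move=> _ [a [Aa ->]]; apply: gen_sub; apply/inM_mon/upc_sub.
  - done.
  - rewrite -gen_mons // => y hy.
    (* Minimality of [gen (loc phi)] is against ideals of [loc phi] only, so the ideal of the larger
       ring is first contracted. *)
    suff [] : (loc phi y /\ gen (loc blow) G y) by [].
    move: y hy; apply: gen_min; last first.
      by move=> y Gy; split; [by case: Gy => [a [_ ->]]; apply: loc_poly|apply: gen_sub].
    have [P0 [P1 [PB PM]]] := loc_subring phi_inj.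
    have [_ [_ [PD _]]] := subring_ideal (loc_subring phi_inj).
    split; first by move=> y [].
    split=> //; split; first by move=> y z [y1 y2] [z1 z2]; split; [apply: PD|apply: GD].
    by move=> s y ls [y1 y2]; split; [apply: PM|apply: GM => //; apply: loc_le].
  - by apply: gen_ideal => // y hy; apply: loc_le; have [h _] := inM_ideal phi_inj A; apply: h.
apply: subset_eq; apply: gen_min.
- by apply: iprod_ideal => //; [apply: ipow_ideal|apply: gen_ideal].
- move=> _ [a [Aa ->]].
  have -> : phi 'X_[a] = x ^+ o * (phi 'X_[a] / x ^+ o).
    by rewrite mulrC divfK // expf_neq0 // x_neq0.
  apply: iprod_mul; last by apply: gen_sub; exists a.
  elim: (o) => [|n IH]; first by have [_ [? _]] := hS.
  rewrite exprSr; apply: iprod_mul => //; apply: gen_sub.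
  by rewrite maxid_loc //; apply/inM_mon/upc_sub; exists i.
- exact: hG.
move=> _ [u [z [hu [hz ->]]]].
have [s ls ->] : exists2 s, loc blow s & u = x ^+ o * s.
  elim: (o) u hu => [|n IH] u; first by exists u => //; rewrite mul1r.
  pose Jn n u := exists2 s, loc blow s & u = x ^+ n * s.
  have hJ l : is_ideal (loc blow) (Jn l).
    have [_ [D0 [DD DM]]] := subring_ideal hS.
    split; first move=> _ [s ls ->].
      by apply: (SM) => //; elim: (l) => [|n' IH']; [rewrite expr0 -(rmorph1 blow); apply: loc_poly|
        rewrite exprS; apply: SM => //; apply/loc_le/loc_poly].
    split; first by exists 0 => //; rewrite mulr0.
    split; first by move=> _ _ [s ls ->] [t lt ->]; exists (s + t); [apply: DD|rewrite mulrDr].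
    by move=> r _ lr [s ls ->]; exists (r * s); [apply: DM|ring].
  have h1 : subset (gen (loc blow) (maxid (loc phi))) (Jn 1%N).
    by apply: gen_min => // y /maxid_mul_x[s ls ->]; exists s.
  apply: (gen_min (hJ n.+1)) => _ [v [w [/IH[s ls ->] [/h1[t lt ->] ->]]]].
  by exists (s * t); [apply: SM|rewrite mulrACA -exprD addn1].
suff : gen (loc blow) G (x ^+ o * z).
  by move=> h; rewrite [x ^+ o * s]mulrC -mulrA; apply: GM.
suff [] : loc blow z /\ gen (loc blow) G (x ^+ o * z) by [].
move: z hz; apply: gen_min.
  have [_ [D0 [DD DM]]] := subring_ideal hS.
  split; first by move=> y [].
  split; first by rewrite mulr0.
  split; first by move=> y z [y1 y2] [z1 z2]; rewrite mulrDr; split; [apply: DD|apply: GD].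
  by move=> r y lr [y1 y2]; rewrite mulrCA; split; [apply: DM|apply: GM].
move=> y gy; split; first exact: gS.
have [a [Aa ->]] := gy; rewrite mulrC divfK ?expf_neq0 ?x_neq0 //.
by apply: gen_sub; exists a.
Qed.

End Blowup.

(** * Consequences of finite support *)

Lemma base_points_pigeonhole (F : fieldType) (S I : F -> Prop) (X : eqType)
    (T : X -> F -> Prop) :
  finitely_supported S I ->
  (forall n, exists s : seq X, [/\ uniq s, size s = n, {in s, forall c, base_point S I (T c)}
     & {in s &, forall c c', T c = T c' -> c = c'}]) -> False.
Proof.
move=> [_ [L hL]] /(_ (size L).+1)[s [us ss bs ts]].
have {}hL : {in s, forall c, exists2 T', Stdlib.Lists.List.In T' L & T c = T'}.
  by move=> c /bs/hL[T' hT' /seteq_eq e]; exists T'.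
have {ss} : (size L < size s)%N by rewrite ss.
elim: L s us {bs} ts hL => [|T0 L IH] s us ts hL.
  by case: s hL {us ts} => // c s /(_ c); rewrite inE eqxx => /(_ isT)[].
have [[c cs e0]|no] := classic (exists2 c, c \in s & T c = T0).
  move=> sz; apply: (IH (rem c s)); first exact: rem_uniq.
  - by move=> a b /mem_rem ha /mem_rem hb; apply: ts.
  - move=> a; rewrite mem_rem_uniq // inE => /andP[ac as_].
    have [T' [e'|hT'] e] := hL a as_; last by exists T'.
    by case/eqP: ac; apply: ts => //; rewrite e0 e' e.
  by rewrite size_rem //; move: sz => /=; case: (s) cs.
move=> /ltnW sz; apply: (IH s) => //.
move=> a as_; have [T' [e'|hT'] e] := hL a as_; last by exists T'.
by case: no; exists a => //; rewrite e e'.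
Qed.

Section BasePoints.
Variables (k F : fieldType) (d : nat).
Local Notation mon := 'X_{1..d}.
Implicit Types (A : mon -> Prop) (a b : mon).

Lemma exists_order (phi : {rmorphism {mpoly k[d]} -> F}) A : injective phi ->
  (exists a, A a) -> exists o, ord_eq (loc phi) (inM phi A) o.
Proof.
move=> phi_inj [a0 Aa0].
have ex : exists n, asb (exists2 a, A a & mdeg a = n) by exists (mdeg a0); apply/asbP; exists a0.
exists (ex_minn ex); apply/ord_inM => //; case: ex_minnP => n /asbP[a Aa an] hn; split.
  by move=> b Ab; apply: hn; apply/asbP; exists b.
by exists a.
Qed.

(** The exponent left after substituting [x_j = x_i * y_j] for [j != i] and dividing by
    [x_i ^ o]. *)
Definition chart_map (i : 'I_d) o a : mon :=
  [multinom if j == i then (mdeg a - o)%N else a j | j < d].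

Definition chart_image (i : 'I_d) o A : mon -> Prop :=
  fun b => exists a, A a /\ b = chart_map i o a.

Lemma blow_origin (phi : {rmorphism {mpoly k[d]} -> F}) (i : 'I_d) A o :
  injective phi -> ord_eq (loc phi) (inM phi A) o ->
  is_transform (loc phi) (inM phi A) (loc (blow phi i (fun=> 0)))
    (inM (blow phi i (fun=> 0)) (chart_image i o A)).
Proof.
move=> phi_inj ho; have := blow_is_transform phi_inj i (fun=> 0) ho.
suff -> : inM (blow phi i (fun=> 0)) (chart_image i o A) =
  gen (loc (blow phi i (fun=> 0))) (blow_gens phi i A o) by [].
rewrite -(gen_mons (@blow_inj _ _ _ _ phi_inj i (fun=> 0))); congr gen; apply: seteq_eq => y.
have [hA _] := (ord_inM phi_inj A o).1 ho.
have E a : A a -> phi 'X_[a] / phi 'X_i ^+ o = blow phi i (fun=> 0) 'X_[chart_map i o a].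
  move=> /hA oa; rewrite (blow_genE phi_inj _ (fun=> 0)) //; congr (blow _ _ _ _).
  rewrite [in RHS]mpolyXE_id (bigD1 i) //= [in RHS](bigD1 i) //= mnmE eqxx.
  rewrite /blow_rest eqxx expr1n mul1r; congr (_ * _).
  by apply: eq_bigr => j /negbTE ji; rewrite ji mnmE ji mpolyC0 addr0.
split=> [[_ [[a [Aa ->]] ->]]|[a [Aa ->]]]; first by exists a; rewrite E.
by exists (chart_map i o a); split; [exists a|rewrite -E].
Qed.

(** No power of [x_i] lies in [I]. Since [chart_map i] changes only coordinate [i], this persists at
    the origins of the successive charts. *)
Definition off_axis (i : 'I_d) A := forall a, A a -> exists2 j, j != i & a j != 0%N.

(** If [x_j / x_i] were in the old ring, [x_j] would be a multiple of [x_i] there. Strictness makes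
    the points of a chain distinct. *)
Lemma blow_strict (phi : {rmorphism {mpoly k[d]} -> F}) (i j : 'I_d) (c : 'I_d -> k) :
  injective phi -> j != i -> subset (loc phi) (loc (blow phi i c)) /\
  ~ subset (loc (blow phi i c)) (loc phi).
Proof.
move=> phi_inj ji; split.
  by move=> y /(loc_chart i); apply: chart_sub.
move=> h.
have [_ [_ [SB _]]] := loc_subring phi_inj.
have hy : loc phi (phi 'X_j / phi 'X_i).
  have := h _ (loc_poly (blow phi i c) ('X_j + (c j)%:MP)).
  by rewrite rmorphD blowXj // blowC subrK.
have : inM phi (fun m => m = U_(i)%MM) (phi 'X_j).
  have -> : phi 'X_j = phi 'X_j / phi 'X_i * phi 'X_i by rewrite divfK // x_neq0.
  have [_ [_ [_ hm]]] := inM_ideal phi_inj (fun m => m = U_(i)%MM).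
  by apply: hm => //; apply/inM_mon/upc_sub.
move=> /(inM_phi phi_inj)/(_ U_(j)%MM); rewrite msuppX inE eqxx => /(_ isT)[_ [-> ]].
by rewrite lep1mP mnm1E (negbTE ji).
Qed.

Lemma origin_chain (S I : F -> Prop) (i j : 'I_d) n : j != i ->
  forall (phi : {rmorphism {mpoly k[d]} -> F}) A, injective phi -> (exists a, A a) ->
  off_axis i A -> infnear S I (loc phi) (inM phi A) ->
  exists t : nat -> F -> Prop, t 0%N = loc phi /\
    forall m, (m <= n)%N -> base_point S I (t m) /\ subset (t m) (t m.+1) /\
      ~ subset (t m.+1) (t m).
Proof.
move=> ji; elim: n => [|n IH] phi A phi_inj A0 hA near.
all: have [o ho] := exists_order phi_inj A0.
all: have bp : base_point S I (loc phi).
1,3: exists (inM phi A); split=> //; rewrite maxid_loc // ipow_inM //.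
1,2: apply: inM_sub => a /hA[l _ al]; apply/upc_Mset_pow; rewrite mdegE (bigD1 l) //= ltn_addr //.
1,2: by rewrite lt0n.
all: have st := blow_strict (fun=> 0) phi_inj ji.
  exists (fun m => if m is 0%N then loc phi else loc (blow phi i (fun=> 0))).
  by split=> // m; rewrite leqn0 => /eqP ->.
have near' := infnear_step near (blow_quad_transform phi_inj i (fun=> 0))
  (blow_origin i phi_inj ho).
have [||t [t0 ht]] := IH _ _ (@blow_inj _ _ _ _ phi_inj i (fun=> 0)) _ _ near'.
- by have [a Aa] := A0; exists (chart_map i o a), a.
- move=> _ [a [/hA[l li al] ->]]; exists l => //; by rewrite mnmE (negbTE li).
exists (fun m => if m is m'.+1 then t m' else loc phi); split=> // -[|m] mn.
  by rewrite t0.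
exact: ht.
Qed.

Lemma finitely_supported_pure_powers (phi : {rmorphism {mpoly k[d]} -> F}) A :
  injective phi -> (1 < d)%N -> (exists a, A a) ->
  finitely_supported (loc phi) (inM phi A) -> has_pure_powers A.
Proof.
move=> phi_inj d2 A0 fs i; apply: NNPP => no.
have hA : off_axis i A.
  move=> a Aa; apply: NNPP => h; apply: no; exists (a i), a; split=> //.
  apply/mnm_lepP => l; rewrite mulmnE mnm1E; case: eqP => [->|/eqP il]; first by rewrite mul1n.
  rewrite mul0n leqn0; apply: contraT => al; case: h; exists l => //; by rewrite eq_sym.
have [j ji] : exists j : 'I_d, j != i.
  case: (eqVneq (Ordinal d2) i) => [<-|?]; last by exists (Ordinal d2).
  by exists (Ordinal (ltnW d2)).
have chain n := origin_chain n ji phi_inj A0 hA (infnear_refl _ _).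
(* The chain is chosen separately for each length [n], so points are indexed by pairs and compared
   only within one chain. *)
pose T (z : nat * nat) := sval (constructive_indefinite_description _ (chain z.1)) z.2.
have TP n m : (m <= n)%N -> base_point (loc phi) (inM phi A) (T (n, m)) /\
    subset (T (n, m)) (T (n, m.+1)) /\ ~ subset (T (n, m.+1)) (T (n, m)).
  by rewrite /T /=; case: constructive_indefinite_description => t [_ ht] /=; apply: ht.
apply: (base_points_pigeonhole (T := T) fs) => n; exists [seq (n, m) | m <- iota 0 n].
have le m m' : (m <= m')%N -> (m' <= n)%N -> subset (T (n, m)) (T (n, m')).
  elim: m' => [|m' IH']; first by rewrite leqn0 => /eqP -> _ y.
  rewrite leq_eqVlt => /orP[/eqP -> _ y //|mm mn y hy].
  have [_ [h _]] := TP n m' (ltnW mn); apply: h; apply: IH' => //; exact: ltnW.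
have lt m m' : (m < m')%N -> (m' < n)%N -> T (n, m) <> T (n, m').
  move=> mm mn e; have [_ [_ []]] := TP n m (ltnW (ltn_trans mm mn)).
  by rewrite e; apply: le => //; apply: ltnW.
split; [by rewrite map_inj_uniq ?iota_uniq // => ? ? []|by rewrite size_map size_iota| |].
  move=> z /mapP[m]; rewrite mem_iota => /= mn ->; by have [] := TP n m (ltnW mn).
move=> z z' /mapP[m hm ->] /mapP[m' hm' ->]; move: hm hm'; rewrite !mem_iota /= => hm hm' e.
case: (ltngtP m m') => [h|h|->] //; first by case: (lt m m').
by case: (lt m' m).
Qed.

End BasePoints.

Lemma closed_field_uniq (k : closedFieldType) n : exists s : seq k, uniq s /\ size s = n.
Proof.
elim: n => [|n [s [us ss]]]; first by exists [::].
have : \prod_(a <- s) ('X - a%:P) != 0.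
  by rewrite monic_neq0 // monic_prod_XsubC.
move=> /closed_nonrootP[x]; rewrite root_prod_XsubC => xs.
by exists (x :: s); rewrite /= xs us ss.
Qed.

Lemma finitely_supported_edge (k : closedFieldType) (F : fieldType) (d : nat)
    (phi : {rmorphism {mpoly k[d]} -> F}) (A : 'X_{1..d} -> Prop) o :
  injective phi -> finitely_supported (loc phi) (inM phi A) ->
  ord_eq (loc phi) (inM phi A) o -> edge_property A o.
Proof.
move=> phi_inj fs ho i j ij; apply: NNPP => no.
have ji : j != i by rewrite eq_sym.
have [hA _] := (ord_inM phi_inj A o).1 ho.
(* These are the points of the line joining the coordinate points [i] and [j], seen in the chart
   [x_i]. *)
pose c z (l : 'I_d) : k := if l == j then z else 0.
apply: (base_points_pigeonhole (T := fun z : k => loc (blow phi i (c z))) fs) => n.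
have [s [us ss]] := closed_field_uniq k n; exists s; split=> //.
  move=> z _; exists (gen (loc (blow phi i (c z))) (blow_gens phi i A o)); split.
    apply: infnear_step (infnear_refl _ _) _ _; first exact: blow_quad_transform.
    exact: blow_is_transform.
  have hM : is_ideal (loc (blow phi i (c z))) (maxid (loc (blow phi i (c z)))).
    by rewrite maxid_blow_inM //; apply: inM_ideal (@blow_inj _ _ _ _ phi_inj i (c z)) _.
  rewrite ipow1 //; last exact: loc_subring (@blow_inj _ _ _ _ phi_inj i (c z)).
  apply: gen_min => // _ [a [Aa ->]].
  rewrite (blow_genE phi_inj i (c z)) ?hA //; apply/maxid_poly => //; rewrite mcoeff0M.
  (* The generator vanishes at the point through a factor [x_i] if [mdeg a > o], and otherwise
     through a factor [x_l / x_i] with [l] outside [{i, j}], as [a] is no edge monomial. *)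
  have [ao|ao] := eqVneq (mdeg a) o; last first.
    have : (0 < mdeg a - o)%N by rewrite subn_gt0 ltn_neqAle eq_sym ao hA.
    by case: (mdeg a - o)%N => // n' _; rewrite exprS mcoeff0M mcoeffX mnm1_eq0 !mul0r.
  have [l [li lj al]] : exists l, [/\ l != i, l != j & a l != 0%N].
    apply: NNPP => h; apply: no; exists a; split=> //; split=> // l li lj.
    by apply/eqP; apply: contraT => al; case: h; exists l.
  rewrite (bigD1 l) //= mcoeff0M; case: (a l) al => // n' _.
  rewrite exprS mcoeff0M /blow_rest (negbTE li) mcoeffD mcoeffX mnm1_eq0 add0r.
  by rewrite mpolyCK /c (negbTE lj) !mul0r mulr0.
move=> z z' _ _ e.
(* The point is recovered from its local ring: the maximal ideal contains [x_j / x_i - w] for only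
   one constant [w]. *)
have h w : maxid (loc (blow phi i (c w))) (phi 'X_j / phi 'X_i - phi w%:MP).
  have -> : phi 'X_j / phi 'X_i - phi w%:MP = blow phi i (c w) 'X_j.
    by rewrite blowXj // /c eqxx.
  by apply/maxid_poly => //; rewrite mcoeffX mnm1_eq0.
have h1 := h z; have h2 := h z'; rewrite -e in h2.
have hM : is_ideal (loc (blow phi i (c z))) (maxid (loc (blow phi i (c z)))).
  by rewrite maxid_blow_inM //; apply: inM_ideal (@blow_inj _ _ _ _ phi_inj i (c z)) _.
have := ideal_sub (loc_subring (@blow_inj _ _ _ _ phi_inj i (c z))) hM h2 h1.
have -> : phi 'X_j / phi 'X_i - phi z'%:MP - (phi 'X_j / phi 'X_i - phi z%:MP) =
    blow phi i (c z) (z - z')%:MP by rewrite blowC mpolyCB rmorphB; ring.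
by move=> /maxid_poly => /(_ phi_inj); rewrite mpolyCK => /eqP; rewrite subr_eq0 => /eqP.
Qed.

(** * Both statements for a finitely supported monomial ideal *)

Section MonomialLocalRing.
Variables (k : closedFieldType) (d : nat) (A : 'X_{1..d} -> Prop) (o : nat).
Hypothesis d2 : (1 < d)%N.
Variables (F : fieldType) (phi : {rmorphism {mpoly k[d]} -> F}).
Hypothesis phi_inj : injective phi.
Hypothesis fs : finitely_supported (loc phi) (inM phi A).
Hypothesis ho : ord_eq (loc phi) (inM phi A) o.

Let hA : forall a, A a -> (o <= mdeg a)%N.
Proof. by have [] := (ord_inM phi_inj A o).1 ho. Qed.

Let pure : has_pure_powers A.
Proof.
apply: (finitely_supported_pure_powers phi_inj) => //.
by have [_ [a Aa _]] := (ord_inM phi_inj A o).1 ho; exists a.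
Qed.

Let edge : edge_property A o.
Proof. exact: finitely_supported_edge fs ho. Qed.

Let count : exists s, uniq s /\ size s = 'C(o + d - 1, d - 1) /\
    forall a, a \in s <-> newton A a /\ ~ newton (shiftM A) a.
Proof.
apply: newton_count => //.
have [D hD] := pure_powers_deg (pure_powers_newton (pure_powers_shiftM pure)).
by exists D => a /hD/upc_newton.
Qed.

Lemma length_iclos_quotient :
  length_eq (loc phi) (iclos (loc phi) (iprod (loc phi) (maxid (loc phi)) (inM phi A)))
    (iclos (loc phi) (inM phi A)) 'C(o + d - 1, d - 1).
Proof.
have d0 := ltnW d2.
rewrite iprod_maxid // !iclos_inM //; last exact: pure_powers_shiftM.
have [s [us [<- hs]]] := count; apply: length_inM => //.
  by move=> b /newton_shiftM/upc_sub.
by move=> a; rewrite !upc_newton.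
Qed.

(** For closed [I], the exponents counted by the binomial are the minimal generators of [I] outside
    the polyhedron of [MI]. So the binomial is at most [mu(I)], and equality means that no minimal
    generator lies in that polyhedron, that is, [MI] is closed. *)
Lemma int_closed_prod_mu : int_closed (loc phi) (inM phi A) ->
  int_closed (loc phi) (iprod (loc phi) (maxid (loc phi)) (inM phi A)) <->
  mu_eq (loc phi) (inM phi A) 'C(o + d - 1, d - 1).
Proof.
have d0 := ltnW d2; have pure' := pure_powers_shiftM pure.
move=> /seteq_eq; rewrite iclos_inM // => /(inM_eqP phi_inj) ic.
have {}ic a : upc A a <-> newton A a by rewrite -upc_newton; split=> /ic.
have [s [us [ss hs]]] := count.
rewrite /int_closed iprod_maxid // iclos_inM //; split.
  move=> /seteq_eq/(inM_eqP phi_inj) ic'; rewrite -ss; apply: mu_inM => // a.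
  by rewrite ic -ic' upc_newton.
move=> [[g [sg eg]] _].
have [D hD] := pure_powers_deg pure'.
pose P a := asb (upc A a) && ~~ asb (upc (shiftM A) a).
pose t := [seq a <- mons_lt d D | P a].
have ut : uniq t by rewrite filter_uniq ?mons_lt_uniq.
have ht a : a \in t <-> upc A a /\ ~ upc (shiftM A) a.
  rewrite mem_filter mem_mons_lt; split=> [/andP[/andP[/asbP ? /asbP ?] _]//|[h1 h2]].
  apply/andP; split; first by apply/andP; split; apply/asbP.
  by rewrite ltnNge; apply/negP => /hD.
have [_ hmin'] := mu_inM phi_inj ut ht.
have st : subpred (mem s) (mem t).
  move=> a /hs[h1 h2]; apply/ht; split; first exact/ic.
  move=> [b [hb ba]]; apply: h2; exact: newton_mem hb ba.
have le : (size t <= size s)%N by rewrite ss -sg; apply: hmin'.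
have [_ e] := uniq_min_size us st le.
suff -> : inM phi (newton (shiftM A)) = inM phi (shiftM A) by [].
apply: inM_eq => a; rewrite upc_newton; split=> [h|[b [hb ba]]]; last exact: newton_mem hb ba.
apply: NNPP => nh; have : a \in t by apply/ht; split=> //; apply/ic/newton_shiftM.
by rewrite -e => /hs[_].
Qed.

End MonomialLocalRing.

Theorem theorem5p4 (k : closedFieldType) (d : nat) (I : Kfld k d -> Prop) :
  (2 <= d)%N -> monomial_ideal I -> finitely_supported (@locR k d) I ->
  (forall o, ord_eq (@locR k d) I o ->
     length_eq (@locR k d) (iclos (@locR k d) (iprod (@locR k d) (@Mloc k d) I))
       (iclos (@locR k d) I) 'C(o + d - 1, d - 1)) /\
  ((3 <= d)%N -> int_closed (@locR k d) I ->
     forall o, ord_eq (@locR k d) I o ->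
       (int_closed (@locR k d) (iprod (@locR k d) (@Mloc k d) I) <->
        mu_eq (@locR k d) I 'C(o + d - 1, d - 1))).
Proof.
move=> d2 [A /seteq_eq eI] fs.
(* This is [embK] as a ring morphism, for which [locR] is [loc phi] by conversion. *)
pose phi : {rmorphism {mpoly k[d]} -> {fraction {mpoly k[d]}}} := @FracField.tofrac _.
have phi_inj : injective phi by move=> p q /eqP; rewrite tofrac_eq => /eqP.
have locE : @locR k d = loc phi by [].
have {}eI : I = inM phi A by rewrite eI locE; exact: (gen_mons phi_inj).
rewrite /Mloc locE eI in fs *; split=> [o ho|_ ic o ho].
  exact: length_iclos_quotient.
exact: int_closed_prod_mu.
Qed.
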